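(* Let $K$ be an arbitrary field, let $m\ge 3$ be an integer, and let $\mathbf{W}$ be a variety of Poisson algebras over $K$ satisfying a nontrivial Lie identity of degree $m$. Let $\mathcal{C}(\mathbf{W},z)=\sum_{n=0}^\infty \frac{c_n(\mathbf{W})}{n!}z^n$ be its complexity function. Then: (1) The following coefficientwise bound holds: $$\mathcal{C}(\mathbf{W},z)\preceq \underbrace{\exp(z\exp(z\exp(\cdots(z\exp(z\exp}_{m-1\text{ times }\exp} z))\cdots))),$$ that is, $\mathcal{C}(\mathbf{W},z)\preceq \tilde q_m(z)$, where $\tilde q_2(z)=\exp(z)$ and $\tilde q_{k+1}(z)=\exp(z\,\tilde q_k(z))$ for $k\ge 2$. (2) There exists an infinitesimal $o(1)$ (a sequence tending to $0$ as $n\to\infty$) such that $$c_n(\mathbf{W})\le \frac{n!}{(\ln^{(m-2)}n)^n}\,(1+o(1))^n,\qquad n\to\infty.$$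
   Context: A Poisson algebra over $K$ is a $K$-vector space $A$ with two $K$-bilinear operations: a commutative associative multiplication with unit $a\cdot b$, and a Lie bracket $\{a,b\}$ (the Poisson bracket), related by the Leibniz rule $\{a\cdot b,c\}=a\cdot\{b,c\}+b\cdot\{a,c\}$. Let $X=\{X_i\mid i\in\mathbb{N}\}$ and let $L(X)$ be the free Lie algebra on $X$. The free Poisson algebra on $X$ is the symmetric algebra $F(X)=S(L(X))$ with the Poisson bracket extending the bracket of $L(X)$ by the Leibniz rule. Identities of Poisson algebras are elements of $F(X)$; a (pure) Lie identity is an element of $L(X)\subset F(X)$, and it is nontrivial if it is nonzero in $L(X)$. Let $P_n\subset F(X)$ be the span of all multilinear monomials of degree $n$ in $X_1,\dots,X_n$ (products of Lie commutators in which each of $X_1,\dots,X_n$ occurs exactly once). For a variety $\mathbf{W}$ of Poisson algebras, let $F(\mathbf{W},X)$ be its relatively free algebra on $X$ and $\phi:F(X)\to F(\mathbf{W},X)$ the natural epimorphism. The (ordinary) codimension sequence is $c_n(\mathbf{W})=\dim_K\phi(P_n)$, $n\ge 0$. For power series with real coefficients, $\sum a_nz^n\preceq\sum b_nz^n$ means $a_n\le b_n$ for all $n\ge0$. Iterated logarithms: $\ln^{(1)}x=\ln x$, $\ln^{(k+1)}x=\ln(\ln^{(k)}x)$. *)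

(* Defs.v *)
From HB Require Import structures.
From mathcomp Require Import all_boot all_order all_algebra.
From mathcomp Require Import ring.
From mathcomp Require Import all_classical all_reals all_analysis.
Set Implicit Arguments.
Unset Strict Implicit.
Unset Printing Implicit Defensive.
Import Order.TTheory GRing.Theory Num.Theory.
Import numFieldNormedType.Exports.
Local Open Scope classical_set_scope.
Local Open Scope ring_scope.
Local Open Scope quotient_scope.

HB.mixin Record isLieAlgebra (K : fieldType) L of GRing.Lmodule K L := {
  lie : L -> L -> L;
  liePl : forall (a : K) x y z, lie (a *: x + y) z = a *: lie x z + lie y z;
  liePr : forall (a : K) x y z, lie x (a *: y + z) = a *: lie x y + lie x z;
  liexx : forall x, lie x x = 0;
  lie_jacobi : forall x y z,
    lie x (lie y z) + lie y (lie z x) + lie z (lie x y) = 0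
}.

#[short(type="lieAlgType")]
HB.structure Definition LieAlgebra (K : fieldType) :=
  {L of isLieAlgebra K L & GRing.Lmodule K L}.

(* The multiplication is not taken from [comAlgType], which forces 1 != 0: the
   zero algebra is a Poisson algebra. *)
HB.mixin Record isPoissonAlgebra (K : fieldType) A of LieAlgebra K A := {
  pone : A;
  pmul : A -> A -> A;
  pmulA : associative pmul;
  pmulC : commutative pmul;
  pmul1 : left_id pone pmul;
  pmulPl : forall (a : K) x y z,
    pmul (a *: x + y) z = a *: pmul x z + pmul y z;
  leibnizl : forall x y z : A,
    lie (pmul x y) z = pmul x (lie y z) + pmul y (lie x z)
}.

#[short(type="poissonAlgType")]
HB.structure Definition PoissonAlgebra (K : fieldType) :=
  {A of isPoissonAlgebra K A & LieAlgebra K A}.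

Definition lie_hom (K : fieldType) (L M : lieAlgType K) (h : L -> M) : Prop :=
  linear h /\ forall x y, h (lie x y) = lie (h x) (h y).

Definition poisson_hom (K : fieldType) (A B : poissonAlgType K) (h : A -> B) :
    Prop :=
  [/\ linear h, h pone = pone, forall x y, h (pmul x y) = pmul (h x) (h y) &
      forall x y, h (lie x y) = lie (h x) (h y)].

Lemma linear_facts (K : fieldType) (U V : lmodType K) (f : U -> V) : linear f ->
  [/\ f 0 = 0, {morph f : x y / x + y}, {morph f : x / - x} &
      forall a, {morph f : x / a *: x}].
Proof.
move=> flin.
have f0 : f 0 = 0.
  have := flin 1 0 0; rewrite !scale1r addr0 => e.
  by apply: (addrI (f 0)); rewrite addr0 -e.
have fZ a : {morph f : x / a *: x}.
  by move=> x; have := flin a x 0; rewrite f0 !addr0.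
split=> // [x y|x]; first by have := flin 1 x y; rewrite !scale1r.
by rewrite -scaleN1r fZ scaleN1r.
Qed.

Section LieTheory.
Variables (K : fieldType) (L : lieAlgType K).
Implicit Types x y z : L.

Lemma lieDl x y z : lie (x + y) z = lie x z + lie y z.
Proof. by have := liePl 1 x y z; rewrite !scale1r. Qed.
Lemma lieDr x y z : lie x (y + z) = lie x y + lie x z.
Proof. by have := liePr 1 x y z; rewrite !scale1r. Qed.
Lemma lieC x y : lie x y = - lie y x.
Proof.
have := liexx (x + y); rewrite lieDl !lieDr !liexx add0r addr0.
by move/eqP; rewrite addr_eq0 => /eqP.
Qed.
Lemma lie0l z : lie 0 z = 0.
Proof. by apply: (addrI (lie 0 z)); rewrite -lieDl !addr0. Qed.
Lemma lie0r z : lie z 0 = 0.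
Proof. by rewrite lieC lie0l oppr0. Qed.
Lemma lieZl (a : K) x z : lie (a *: x) z = a *: lie x z.
Proof. by have := liePl a x 0 z; rewrite !addr0 lie0l addr0. Qed.
Lemma lieZr (a : K) x z : lie x (a *: z) = a *: lie x z.
Proof. by have := liePr a x z 0; rewrite !addr0 lie0r addr0. Qed.
Lemma lieNl x y : lie (- x) y = - lie x y.
Proof. by rewrite -scaleN1r lieZl scaleN1r. Qed.
Lemma lieNr x y : lie x (- y) = - lie x y.
Proof. by rewrite -scaleN1r lieZr scaleN1r. Qed.
End LieTheory.

Definition lspan (K : fieldType) (V : lmodType K) (G : set V) : set V :=
  [set v | exists s : seq (K * V),
     (forall p, p \in s -> G p.2) /\ v = \sum_(p <- s) p.1 *: p.2].

Definition lfree (K : fieldType) (V : lmodType K) (d : nat) (b : 'I_d -> V) :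
    Prop :=
  forall a : 'I_d -> K, \sum_(i < d) a i *: b i = 0 -> forall i, a i = 0.

Definition has_dim (K : fieldType) (V : lmodType K) (U : set V) (d : nat) :
    Prop :=
  exists b : 'I_d -> V, lfree b /\ lspan (range b) = U.

(* 0 when U is not a finite-dimensional subspace; see [codim_has_dim] below. *)
Definition dimension (K : fieldType) (V : lmodType K) (U : set V) : nat :=
  xget 0%N [set d | has_dim U d].

Lemma lspan_rangeP (K : fieldType) (V : lmodType K) d (b : 'I_d -> V) (v : V) :
  lspan (range b) v <-> exists a : 'I_d -> K, v = \sum_(i < d) a i *: b i.
Proof.
split=> [[s [sG ->]]|[a ->]]; last first.
  exists [seq (a i, b i) | i <- index_enum 'I_d]; rewrite big_map; split=> //.
  by move=> p /mapP[i _ ->]; exists i.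
elim: s sG => [|[c w] s IH] sG.
  by exists (fun=> 0); rewrite big_nil big1 // => i _; rewrite scale0r.
have [a aE] : exists a : 'I_d -> K,
    \sum_(p <- s) p.1 *: p.2 = \sum_(i < d) a i *: b i.
  by apply: IH => p ps; apply: sG; rewrite inE ps orbT.
have [j _ /= jE] : range b w by exact: (sG (c, w) (mem_head _ _)).
exists (fun i => a i + c * (i == j)%:R).
under [RHS]eq_bigr do rewrite scalerDl.
rewrite big_cons big_split /= -aE addrC; congr (_ + _).
rewrite (bigD1 j) //= eqxx mulr1 jE big1 ?addr0 // => i /negPf ->.
by rewrite mulr0 scale0r.
Qed.

Lemma finite_span_has_dim (K : fieldType) (V : lmodType K) (G : set V) :
  finite_set G -> exists d, has_dim (lspan G) d.
Proof.
move=> /finite_seqP[s ->].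
pose P d := `[< exists b : 'I_d -> V, lspan (range b) = lspan [set` s] >].
have exP : exists d, P d.
  exists (size s); apply/asboolP; exists (fun i => s`_i).
  congr lspan; apply/seteqP; split=> [_ [i _ <-]|v /= /(nthP 0)[i si <-]].
    by rewrite /= mem_nth.
  by exists (Ordinal si).
have [d /asboolP[b bE] dmin] := ex_minnP exP.
exists d, b; split=> // a a0 j; apply: contrapT => aj.
case: d => [|d] in b bE dmin a a0 j aj *; first by case: j aj.
suff /dmin : P d by rewrite ltnn.
apply/asboolP; exists (fun i => b (lift j i)); rewrite -bE.
apply/seteqP; split=> v /lspan_rangeP[c ->].
  exists [seq (c i, b (lift j i)) | i <- index_enum 'I_d].
  rewrite big_map; split=> // p /mapP[i _ ->]; exists (lift j i) => //.
pose c' i := c i - c j / a j * a i.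
have -> : \sum_(i < d.+1) c i *: b i = \sum_(i < d.+1) c' i *: b i.
  under [RHS]eq_bigr do rewrite scalerBl -scalerA.
  by rewrite sumrB -scaler_sumr a0 scaler0 subr0.
rewrite (bigD1_ord j) //= {1}/c' divfK ?subrr ?scale0r ?add0r; last exact/eqP.
by apply/lspan_rangeP; exists (fun i => c' (lift j i)).
Qed.

Lemma has_dim_dimension (K : fieldType) (V : lmodType K) (U : set V) d :
  has_dim U d -> has_dim U (dimension U).
Proof. by move=> Ud; rewrite /dimension; case: xgetP => [e -> //|/(_ d)]. Qed.

Section FreeLie.
Variable K : fieldType.

Inductive lie_term : Type :=
| LVar of nat
| LZero
| LOpp of lie_term
| LAdd of lie_term & lie_term
| LScale of K & lie_term
| LBr of lie_term & lie_term.

(* The congruence generated by the axioms of Lie algebras over K. *)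
Inductive lie_cong : lie_term -> lie_term -> Prop :=
| LC_refl t : lie_cong t t
| LC_sym s t : lie_cong s t -> lie_cong t s
| LC_trans s t u : lie_cong s t -> lie_cong t u -> lie_cong s u
| LC_opp s t : lie_cong s t -> lie_cong (LOpp s) (LOpp t)
| LC_add s s' t t' : lie_cong s s' -> lie_cong t t' ->
    lie_cong (LAdd s t) (LAdd s' t')
| LC_scale a s t : lie_cong s t -> lie_cong (LScale a s) (LScale a t)
| LC_br s s' t t' : lie_cong s s' -> lie_cong t t' ->
    lie_cong (LBr s t) (LBr s' t')
| LC_addA s t u : lie_cong (LAdd s (LAdd t u)) (LAdd (LAdd s t) u)
| LC_addC s t : lie_cong (LAdd s t) (LAdd t s)
| LC_add0 t : lie_cong (LAdd LZero t) t
| LC_addN t : lie_cong (LAdd (LOpp t) t) LZero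
| LC_scaleA a b t : lie_cong (LScale a (LScale b t)) (LScale (a * b) t)
| LC_scale1 t : lie_cong (LScale 1 t) t
| LC_scaleDr a s t :
    lie_cong (LScale a (LAdd s t)) (LAdd (LScale a s) (LScale a t))
| LC_scaleDl a b t :
    lie_cong (LScale (a + b) t) (LAdd (LScale a t) (LScale b t))
| LC_brPl a s t u :
    lie_cong (LBr (LAdd (LScale a s) t) u)
             (LAdd (LScale a (LBr s u)) (LBr t u))
| LC_brPr a s t u :
    lie_cong (LBr s (LAdd (LScale a t) u))
             (LAdd (LScale a (LBr s t)) (LBr s u))
| LC_brxx t : lie_cong (LBr t t) LZero
| LC_jacobi s t u :
    lie_cong (LAdd (LAdd (LBr s (LBr t u)) (LBr t (LBr u s)))
                   (LBr u (LBr s t)))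
             LZero.

HB.instance Definition _ := gen_eqMixin lie_term.
HB.instance Definition _ := gen_choiceMixin lie_term.

Definition lie_congb (s t : lie_term) : bool := `[< lie_cong s t >].

Lemma lie_congb_equiv : equiv_class_of lie_congb.
Proof.
split=> [t|s t|t s u]; rewrite /lie_congb.
- by apply/asboolP; exact: LC_refl.
- by apply/asboolP/asboolP; exact: LC_sym.
- by move=> /asboolP st /asboolP tu; apply/asboolP; exact: LC_trans tu.
Qed.
Canonical lie_congb_equivRel := EquivRelPack lie_congb_equiv.

Definition free_lie : Type := {eq_quot lie_congb}.
HB.instance Definition _ : EqQuotient _ lie_congb free_lie :=
  EqQuotient.on free_lie.
HB.instance Definition _ := Choice.on free_lie.

Definition lcls (t : lie_term) : free_lie := \pi_free_lie t.
Let rp (x : free_lie) : lie_term := repr x.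

Lemma lclsP s t : lcls s = lcls t <-> lie_cong s t.
Proof.
split; first by move=> /eqmodP; rewrite /lie_congb /= => /asboolP.
by move=> st; apply/eqmodP/asboolP.
Qed.

Lemma lcls_ind (P : free_lie -> Prop) : (forall t, P (lcls t)) -> forall x, P x.
Proof. by move=> h; elim/quotW. Qed.

Let rpP t : lie_cong (rp (lcls t)) t.
Proof. by apply/lclsP; rewrite /lcls /rp reprK. Qed.

Let addL x y := lcls (LAdd (rp x) (rp y)).
Let oppL x := lcls (LOpp (rp x)).
Let scaleL a x := lcls (LScale a (rp x)).
Let brL x y := lcls (LBr (rp x) (rp y)).

Let addE s t : addL (lcls s) (lcls t) = lcls (LAdd s t).
Proof. by apply/lclsP; apply: LC_add; exact: rpP. Qed.
Let oppE t : oppL (lcls t) = lcls (LOpp t).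
Proof. by apply/lclsP; apply: LC_opp; exact: rpP. Qed.
Let scaleE a t : scaleL a (lcls t) = lcls (LScale a t).
Proof. by apply/lclsP; apply: LC_scale; exact: rpP. Qed.
Let brE s t : brL (lcls s) (lcls t) = lcls (LBr s t).
Proof. by apply/lclsP; apply: LC_br; exact: rpP. Qed.

Let addA : associative addL.
Proof.
elim/lcls_ind=> x; elim/lcls_ind=> y; elim/lcls_ind=> z.
by rewrite !addE; apply/lclsP; exact: LC_addA.
Qed.
Let addC : commutative addL.
Proof.
elim/lcls_ind=> x; elim/lcls_ind=> y.
by rewrite !addE; apply/lclsP; exact: LC_addC.
Qed.
Let add0 : left_id (lcls LZero) addL.
Proof. by elim/lcls_ind=> x; rewrite !addE; apply/lclsP; exact: LC_add0. Qed.
Let addN : left_inverse (lcls LZero) oppL addL.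
Proof.
by elim/lcls_ind=> x; rewrite oppE addE; apply/lclsP; exact: LC_addN.
Qed.
HB.instance Definition _ := GRing.isZmodule.Build free_lie addA addC add0 addN.

Let addE' s t : lcls s + lcls t = lcls (LAdd s t).
Proof. exact: addE. Qed.

Let scaleA a b x : scaleL a (scaleL b x) = scaleL (a * b) x.
Proof.
by elim/lcls_ind: x => x; rewrite !scaleE; apply/lclsP; exact: LC_scaleA.
Qed.
Let scale1 : left_id 1 scaleL.
Proof. by elim/lcls_ind=> x; rewrite scaleE; apply/lclsP; exact: LC_scale1. Qed.
Let scaleDr : right_distributive scaleL +%R.
Proof.
move=> a; elim/lcls_ind=> x; elim/lcls_ind=> y.
by rewrite addE' !scaleE addE'; apply/lclsP; exact: LC_scaleDr.
Qed.
Let scaleDl x : {morph scaleL^~ x : a b / a + b}.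
Proof.
elim/lcls_ind: x => x a b.
by rewrite !scaleE addE'; apply/lclsP; exact: LC_scaleDl.
Qed.
HB.instance Definition _ := GRing.Zmodule_isLmodule.Build K free_lie
  scaleA scale1 scaleDr scaleDl.

Let scaleE' a t : a *: lcls t = lcls (LScale a t).
Proof. exact: scaleE. Qed.

Let brPl (a : K) (x y z : free_lie) :
  brL (a *: x + y) z = a *: brL x z + brL y z.
Proof.
elim/lcls_ind: x => x; elim/lcls_ind: y => y; elim/lcls_ind: z => z.
by rewrite (brE x z) (brE y z) !scaleE' !addE' brE; apply/lclsP; exact: LC_brPl.
Qed.
Let brPr (a : K) (x y z : free_lie) :
  brL x (a *: y + z) = a *: brL x y + brL x z.
Proof.
elim/lcls_ind: x => x; elim/lcls_ind: y => y; elim/lcls_ind: z => z.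
by rewrite (brE x y) (brE x z) !scaleE' !addE' brE; apply/lclsP; exact: LC_brPr.
Qed.
Let brxx (x : free_lie) : brL x x = 0.
Proof. by elim/lcls_ind: x => x; rewrite brE; apply/lclsP; exact: LC_brxx. Qed.
Let br_jacobi (x y z : free_lie) :
  brL x (brL y z) + brL y (brL z x) + brL z (brL x y) = 0.
Proof.
elim/lcls_ind: x => x; elim/lcls_ind: y => y; elim/lcls_ind: z => z.
by rewrite !brE !addE'; apply/lclsP; exact: LC_jacobi.
Qed.
HB.instance Definition _ :=
  isLieAlgebra.Build K free_lie brPl brPr brxx br_jacobi.

Definition lie_var (i : nat) : free_lie := lcls (LVar i).

Lemma lcls0 : lcls LZero = 0.
Proof. by []. Qed.
Lemma lclsD s t : lcls (LAdd s t) = lcls s + lcls t.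
Proof. by rewrite addE'. Qed.
Lemma lclsN t : lcls (LOpp t) = - lcls t.
Proof. by symmetry; exact: oppE. Qed.
Lemma lclsZ a t : lcls (LScale a t) = a *: lcls t.
Proof. by rewrite scaleE'. Qed.
Lemma lcls_lie s t : lcls (LBr s t) = lie (lcls s) (lcls t).
Proof. by symmetry; exact: brE. Qed.

Section UniversalProperty.
Variables (L : lieAlgType K) (x : nat -> L).

Fixpoint lie_eval (t : lie_term) : L :=
  match t with
  | LVar i => x i
  | LZero => 0
  | LOpp t => - lie_eval t
  | LAdd s t => lie_eval s + lie_eval t
  | LScale a t => a *: lie_eval t
  | LBr s t => lie (lie_eval s) (lie_eval t)
  end.

Lemma lie_eval_cong s t : lie_cong s t -> lie_eval s = lie_eval t.
Proof.
elim=> //=.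
- by move=> s' t' u _ -> _ ->.
- by move=> s' t' _ ->.
- by move=> ? ? ? ? _ -> _ ->.
- by move=> ? ? ? _ ->.
- by move=> ? ? ? ? _ -> _ ->.
- by move=> *; rewrite addrA.
- by move=> *; rewrite addrC.
- by move=> *; rewrite add0r.
- by move=> *; rewrite addNr.
- by move=> *; rewrite scalerA.
- by move=> *; rewrite scale1r.
- by move=> *; rewrite scalerDr.
- by move=> *; rewrite scalerDl.
- by move=> *; rewrite liePl.
- by move=> *; rewrite liePr.
- by move=> *; rewrite liexx.
- by move=> *; rewrite lie_jacobi.
Qed.

Lemma free_lie_universal :
  exists! h : free_lie -> L, lie_hom h /\ forall i, h (lie_var i) = x i.
Proof.
pose h (y : free_lie) := lie_eval (rp y).
have hE t : h (lcls t) = lie_eval t by apply: lie_eval_cong; exact: rpP.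
exists h; split; first (split; first split).
- move=> a; elim/lcls_ind=> s; elim/lcls_ind=> t.
  by rewrite -lclsZ -lclsD !hE.
- by elim/lcls_ind=> s; elim/lcls_ind=> t; rewrite -lcls_lie !hE.
- by move=> i; rewrite hE.
move=> g [[glin gbr] gx]; apply/funext; elim/lcls_ind=> t; rewrite hE.
have [g0 gD gN gZ] := linear_facts glin.
elim: t => /= [i||t IH|s IHs t IHt|a t IH|s IHs t IHt].
- by rewrite -gx.
- by rewrite lcls0 g0.
- by rewrite lclsN gN IH.
- by rewrite lclsD gD IHs IHt.
- by rewrite lclsZ gZ IH.
- by rewrite lcls_lie gbr IHs IHt.
Qed.
End UniversalProperty.

End FreeLie.

Section SymmetricAlgebra.
Variables (K : fieldType) (V : lmodType K).

Inductive sym_term : Type :=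
| SInj of V
| SOne
| SOpp of sym_term
| SAdd of sym_term & sym_term
| SScale of K & sym_term
| SMul of sym_term & sym_term.

(* The congruence generated by the axioms of commutative associative unital
   K-algebras and the linearity of the inclusion of V. *)
Inductive sym_cong : sym_term -> sym_term -> Prop :=
| SC_refl t : sym_cong t t
| SC_sym s t : sym_cong s t -> sym_cong t s
| SC_trans s t u : sym_cong s t -> sym_cong t u -> sym_cong s u
| SC_opp s t : sym_cong s t -> sym_cong (SOpp s) (SOpp t)
| SC_add s s' t t' : sym_cong s s' -> sym_cong t t' ->
    sym_cong (SAdd s t) (SAdd s' t')
| SC_scale a s t : sym_cong s t -> sym_cong (SScale a s) (SScale a t)
| SC_mul s s' t t' : sym_cong s s' -> sym_cong t t' ->
    sym_cong (SMul s t) (SMul s' t')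
| SC_addA s t u : sym_cong (SAdd s (SAdd t u)) (SAdd (SAdd s t) u)
| SC_addC s t : sym_cong (SAdd s t) (SAdd t s)
| SC_add0 t : sym_cong (SAdd (SInj 0) t) t
| SC_addN t : sym_cong (SAdd (SOpp t) t) (SInj 0)
| SC_scaleA a b t : sym_cong (SScale a (SScale b t)) (SScale (a * b) t)
| SC_scale1 t : sym_cong (SScale 1 t) t
| SC_scaleDr a s t :
    sym_cong (SScale a (SAdd s t)) (SAdd (SScale a s) (SScale a t))
| SC_scaleDl a b t :
    sym_cong (SScale (a + b) t) (SAdd (SScale a t) (SScale b t))
| SC_mulA s t u : sym_cong (SMul s (SMul t u)) (SMul (SMul s t) u)
| SC_mulC s t : sym_cong (SMul s t) (SMul t s)
| SC_mul1 t : sym_cong (SMul SOne t) t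
| SC_mulDl s t u : sym_cong (SMul (SAdd s t) u) (SAdd (SMul s u) (SMul t u))
| SC_scaleAl a s t : sym_cong (SScale a (SMul s t)) (SMul (SScale a s) t)
| SC_injP a v w :
    sym_cong (SInj (a *: v + w)) (SAdd (SScale a (SInj v)) (SInj w)).

HB.instance Definition _ := gen_eqMixin sym_term.
HB.instance Definition _ := gen_choiceMixin sym_term.

Definition sym_congb (s t : sym_term) : bool := `[< sym_cong s t >].

Lemma sym_congb_equiv : equiv_class_of sym_congb.
Proof.
split=> [t|s t|t s u]; rewrite /sym_congb.
- by apply/asboolP; exact: SC_refl.
- by apply/asboolP/asboolP; exact: SC_sym.
- by move=> /asboolP st /asboolP tu; apply/asboolP; exact: SC_trans tu.
Qed.
Canonical sym_congb_equivRel := EquivRelPack sym_congb_equiv.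

Definition sym_alg : Type := {eq_quot sym_congb}.
HB.instance Definition _ : EqQuotient _ sym_congb sym_alg :=
  EqQuotient.on sym_alg.
HB.instance Definition _ := Choice.on sym_alg.

Definition scls (t : sym_term) : sym_alg := \pi_sym_alg t.
Let rp (x : sym_alg) : sym_term := repr x.

Lemma sclsP s t : scls s = scls t <-> sym_cong s t.
Proof.
split; first by move=> /eqmodP; rewrite /sym_congb /= => /asboolP.
by move=> st; apply/eqmodP/asboolP.
Qed.

Lemma scls_ind (P : sym_alg -> Prop) : (forall t, P (scls t)) -> forall x, P x.
Proof. by move=> h; elim/quotW. Qed.

Let rpP t : sym_cong (rp (scls t)) t.
Proof. by apply/sclsP; rewrite /scls /rp reprK. Qed.

Let addL x y := scls (SAdd (rp x) (rp y)).
Let oppL x := scls (SOpp (rp x)).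
Let scaleL a x := scls (SScale a (rp x)).
Let mulL x y := scls (SMul (rp x) (rp y)).

Let addE s t : addL (scls s) (scls t) = scls (SAdd s t).
Proof. by apply/sclsP; apply: SC_add; exact: rpP. Qed.
Let oppE t : oppL (scls t) = scls (SOpp t).
Proof. by apply/sclsP; apply: SC_opp; exact: rpP. Qed.
Let scaleE a t : scaleL a (scls t) = scls (SScale a t).
Proof. by apply/sclsP; apply: SC_scale; exact: rpP. Qed.
Let mulE s t : mulL (scls s) (scls t) = scls (SMul s t).
Proof. by apply/sclsP; apply: SC_mul; exact: rpP. Qed.

Let addA : associative addL.
Proof.
elim/scls_ind=> x; elim/scls_ind=> y; elim/scls_ind=> z.
by rewrite !addE; apply/sclsP; exact: SC_addA.
Qed.
Let addC : commutative addL.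
Proof.
elim/scls_ind=> x; elim/scls_ind=> y.
by rewrite !addE; apply/sclsP; exact: SC_addC.
Qed.
Let add0 : left_id (scls (SInj 0)) addL.
Proof. by elim/scls_ind=> x; rewrite !addE; apply/sclsP; exact: SC_add0. Qed.
Let addN : left_inverse (scls (SInj 0)) oppL addL.
Proof.
by elim/scls_ind=> x; rewrite oppE addE; apply/sclsP; exact: SC_addN.
Qed.
HB.instance Definition _ := GRing.isZmodule.Build sym_alg addA addC add0 addN.

Let addE' s t : scls s + scls t = scls (SAdd s t).
Proof. exact: addE. Qed.

Let scaleA a b x : scaleL a (scaleL b x) = scaleL (a * b) x.
Proof.
by elim/scls_ind: x => x; rewrite !scaleE; apply/sclsP; exact: SC_scaleA.
Qed.
Let scale1 : left_id 1 scaleL.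
Proof. by elim/scls_ind=> x; rewrite scaleE; apply/sclsP; exact: SC_scale1. Qed.
Let scaleDr : right_distributive scaleL +%R.
Proof.
move=> a; elim/scls_ind=> x; elim/scls_ind=> y.
by rewrite addE' !scaleE addE'; apply/sclsP; exact: SC_scaleDr.
Qed.
Let scaleDl x : {morph scaleL^~ x : a b / a + b}.
Proof.
elim/scls_ind: x => x a b.
by rewrite !scaleE addE'; apply/sclsP; exact: SC_scaleDl.
Qed.
HB.instance Definition _ := GRing.Zmodule_isLmodule.Build K sym_alg
  scaleA scale1 scaleDr scaleDl.

Let scaleE' a t : a *: scls t = scls (SScale a t).
Proof. exact: scaleE. Qed.

Let mulA : associative mulL.
Proof.
elim/scls_ind=> x; elim/scls_ind=> y; elim/scls_ind=> z.
by rewrite !mulE; apply/sclsP; exact: SC_mulA.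
Qed.
Let mulC : commutative mulL.
Proof.
elim/scls_ind=> x; elim/scls_ind=> y.
by rewrite !mulE; apply/sclsP; exact: SC_mulC.
Qed.
Let mul1 : left_id (scls SOne) mulL.
Proof. by elim/scls_ind=> x; rewrite mulE; apply/sclsP; exact: SC_mul1. Qed.
Let mulDl : left_distributive mulL +%R.
Proof.
elim/scls_ind=> x; elim/scls_ind=> y; elim/scls_ind=> z.
by rewrite (mulE x z) (mulE y z) !addE' mulE; apply/sclsP; exact: SC_mulDl.
Qed.
HB.instance Definition _ := GRing.Zmodule_isComPzRing.Build sym_alg
  mulA mulC mul1 mulDl.

Definition sym_inj (v : V) : sym_alg := scls (SInj v).

Lemma scls0 : scls (SInj 0) = 0.
Proof. by []. Qed.
Lemma scls1 : scls SOne = 1.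
Proof. by []. Qed.
Lemma sclsD s t : scls (SAdd s t) = scls s + scls t.
Proof. by rewrite addE'. Qed.
Lemma sclsN t : scls (SOpp t) = - scls t.
Proof. by symmetry; exact: oppE. Qed.
Lemma sclsZ a t : scls (SScale a t) = a *: scls t.
Proof. by rewrite scaleE'. Qed.
Lemma sclsM s t : scls (SMul s t) = scls s * scls t.
Proof. by symmetry; exact: mulE. Qed.

Lemma sym_injP : linear sym_inj.
Proof.
by move=> a v w; rewrite /sym_inj -sclsZ -sclsD; apply/sclsP; exact: SC_injP.
Qed.

Lemma sym_scaleAl a (x y : sym_alg) : a *: (x * y) = (a *: x) * y.
Proof.
elim/scls_ind: x => x; elim/scls_ind: y => y.
by rewrite -sclsM -!sclsZ -sclsM; apply/sclsP; exact: SC_scaleAl.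
Qed.
Lemma sym_scaleAr a (x y : sym_alg) : a *: (x * y) = x * (a *: y).
Proof. by rewrite mulrC sym_scaleAl mulrC. Qed.

Lemma sym_alg_ind (P : sym_alg -> Prop) :
  (forall v, P (sym_inj v)) -> P 1 ->
  (forall x y, P x -> P y -> P (x + y)) -> (forall x, P x -> P (- x)) ->
  (forall a x, P x -> P (a *: x)) -> (forall x y, P x -> P y -> P (x * y)) ->
  forall x, P x.
Proof.
move=> Pi P1 PD PN PZ PM; elim/scls_ind; elim.
- exact: Pi.
- exact: P1.
- by move=> t; rewrite sclsN; exact: PN.
- by move=> s Ps t Pt; rewrite sclsD; exact: PD.
- by move=> a t; rewrite sclsZ; exact: PZ.
- by move=> s Ps t Pt; rewrite sclsM; exact: PM.
Qed.

Section Derivation.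
Variable d : V -> sym_alg.

Fixpoint der_term (t : sym_term) : sym_alg :=
  match t with
  | SInj v => d v
  | SOne => 0
  | SOpp t => - der_term t
  | SAdd s t => der_term s + der_term t
  | SScale a t => a *: der_term t
  | SMul s t => scls s * der_term t + scls t * der_term s
  end.

(* For linear [d], the derivation of S(V) extending [d]. *)
Definition sym_der (x : sym_alg) : sym_alg := der_term (rp x).

Hypothesis dlin : linear d.

Lemma der_term_cong s t : sym_cong s t -> der_term s = der_term t.
Proof.
have [d0 dD dN dZ] := linear_facts dlin.
elim=> //=.
- by move=> s' t' u _ -> _ ->.
- by move=> s' t' _ ->.
- by move=> ? ? ? ? _ -> _ ->.
- by move=> ? ? ? _ ->.
- by move=> ? ? ? ? /sclsP -> -> /sclsP -> ->.
- by move=> *; rewrite d0 add0r.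
- by move=> *; rewrite d0 addNr.
- by move=> *; rewrite scalerDl.
- by move=> s' t' u; rewrite !sclsM; ring.
- by move=> t'; rewrite scls1 mulr0 addr0 mul1r.
- by move=> s' t' u; rewrite !sclsD; ring.
- by move=> a s' t'; rewrite !sclsZ scalerDr sym_scaleAl [X in _ + X]sym_scaleAr.
Qed.

Let derE t : sym_der (scls t) = der_term t.
Proof. by apply: der_term_cong; exact: rpP. Qed.

Lemma sym_der_inj v : sym_der (sym_inj v) = d v.
Proof. exact: derE. Qed.
Lemma sym_der1 : sym_der 1 = 0.
Proof. by rewrite -scls1 derE. Qed.
Lemma sym_derP : linear sym_der.
Proof.
move=> a; elim/scls_ind=> x; elim/scls_ind=> y.
by rewrite -sclsZ -sclsD !derE.
Qed.
Lemma sym_derM x y : sym_der (x * y) = x * sym_der y + y * sym_der x.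
Proof.
by elim/scls_ind: x => x; elim/scls_ind: y => y; rewrite -sclsM !derE.
Qed.
End Derivation.

End SymmetricAlgebra.

Arguments sym_inj {K V} v.

Section SymPoisson.
Variables (K : fieldType) (L : lieAlgType K).
Local Notation S := (sym_alg L).

(* [sym_ad a q] is {a, q} for a in L, the derivation of S(L) extending
   b |-> [a, b]; then {p, q} is the derivation p |-> {p, q} of S(L) extending
   a |-> {a, q}. *)
Definition sym_ad (a : L) : S -> S := sym_der (fun b => sym_inj (lie a b)).
Definition sym_lie (p q : S) : S := sym_der (fun a => sym_ad a q) p.

Let ad_lin (a : L) : linear (fun b => sym_inj (lie a b)).
Proof. by move=> c x y; rewrite liePr sym_injP. Qed.

Let adD a : {morph sym_ad a : x y / x + y}.
Proof. by case: (linear_facts (sym_derP (ad_lin a))). Qed.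
Let adN a : {morph sym_ad a : x / - x}.
Proof. by case: (linear_facts (sym_derP (ad_lin a))). Qed.
Let adZ a c : {morph sym_ad a : x / c *: x}.
Proof. by case: (linear_facts (sym_derP (ad_lin a))). Qed.
Let adM a x y : sym_ad a (x * y) = x * sym_ad a y + y * sym_ad a x.
Proof. exact: sym_derM (ad_lin a) _ _. Qed.
Let ad_inj a b : sym_ad a (sym_inj b) = sym_inj (lie a b).
Proof. exact: sym_der_inj (ad_lin a) _. Qed.
Let ad1 a : sym_ad a 1 = 0.
Proof. exact: sym_der1 (ad_lin a). Qed.

Let lie_lin (q : S) : linear (fun a => sym_ad a q).
Proof.
move=> c a b; elim/sym_alg_ind: q => [v||x y Hx Hy|x Hx|e x Hx|x y Hx Hy].
- by rewrite !ad_inj liePl sym_injP.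
- by rewrite !ad1 scaler0 addr0.
- by rewrite !adD Hx Hy scalerDr addrACA.
- by rewrite !adN Hx opprD scalerN.
- by rewrite !adZ Hx scalerDr !scalerA mulrC.
- by rewrite !adM Hx Hy scalerDr !mulrDr !sym_scaleAr addrACA.
Qed.

Lemma sym_lie_inj a b : sym_lie (sym_inj a) (sym_inj b) = sym_inj (lie a b).
Proof. by rewrite /sym_lie sym_der_inj ?ad_inj //; exact: lie_lin. Qed.

Let slPl (c : K) (x y z : S) :
  sym_lie (c *: x + y) z = c *: sym_lie x z + sym_lie y z.
Proof. exact: sym_derP (lie_lin z) _ _ _. Qed.
Let slM (x y z : S) : sym_lie (x * y) z = x * sym_lie y z + y * sym_lie x z.
Proof. exact: sym_derM (lie_lin z) _ _. Qed.
Let sl_inj a q : sym_lie (sym_inj a) q = sym_ad a q.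
Proof. exact: sym_der_inj (lie_lin q) _. Qed.
Let sl1 q : sym_lie 1 q = 0.
Proof. exact: sym_der1 (lie_lin q). Qed.
Let slD z : {morph sym_lie^~ z : x y / x + y}.
Proof. by case: (linear_facts (sym_derP (lie_lin z))). Qed.
Let slN z : {morph sym_lie^~ z : x / - x}.
Proof. by case: (linear_facts (sym_derP (lie_lin z))). Qed.
Let slZ z c : {morph sym_lie^~ z : x / c *: x}.
Proof. by case: (linear_facts (sym_derP (lie_lin z))). Qed.

Let sr1 x : sym_lie x 1 = 0.
Proof.
elim/sym_alg_ind: x => [a||x y Hx Hy|x Hx|c x Hx|x y Hx Hy].
- by rewrite sl_inj ad1.
- by rewrite sl1.
- by rewrite slD Hx Hy addr0.
- by rewrite slN Hx oppr0.
- by rewrite slZ Hx scaler0.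
- by rewrite slM Hx Hy !mulr0 addr0.
Qed.
Let srP (c : K) (x y z : S) :
  sym_lie x (c *: y + z) = c *: sym_lie x y + sym_lie x z.
Proof.
elim/sym_alg_ind: x => [a||x x' Hx Hy|x Hx|e x Hx|x x' Hx Hy].
- by rewrite !sl_inj adD adZ.
- by rewrite !sl1 scaler0 addr0.
- by rewrite !slD Hx Hy scalerDr addrACA.
- by rewrite !slN Hx opprD scalerN.
- by rewrite !slZ Hx scalerDr !scalerA mulrC.
- by rewrite !slM Hx Hy scalerDr !mulrDr !sym_scaleAr addrACA.
Qed.
Let srM (x y z : S) : sym_lie x (y * z) = y * sym_lie x z + z * sym_lie x y.
Proof.
elim/sym_alg_ind: x => [a||x x' Hx Hy|x Hx|e x Hx|x x' Hx Hy].
- by rewrite !sl_inj adM.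
- by rewrite !sl1 !mulr0 addr0.
- by rewrite !slD Hx Hy; ring.
- by rewrite !slN Hx; ring.
- by rewrite !slZ Hx scalerDr !sym_scaleAr.
- by rewrite !slM Hx Hy; ring.
Qed.
Let srD z : {morph sym_lie z : x y / x + y}.
Proof. by case: (linear_facts (fun c => srP c z)). Qed.
Let srN z : {morph sym_lie z : x / - x}.
Proof. by case: (linear_facts (fun c => srP c z)). Qed.
Let srZ z c : {morph sym_lie z : x / c *: x}.
Proof. by case: (linear_facts (fun c => srP c z)). Qed.
Let sr0 z : sym_lie z 0 = 0.
Proof. by case: (linear_facts (fun c => srP c z)). Qed.

Let sl0 z : sym_lie 0 z = 0.
Proof. by case: (linear_facts (sym_derP (lie_lin z))). Qed.

Let slC (x y : S) : sym_lie x y = - sym_lie y x.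
Proof.
elim/sym_alg_ind: x => [a||x x' Hx Hy|x Hx|c x Hx|x x' Hx Hy].
- elim/sym_alg_ind: y => [b||x y Hx Hy|x Hx|c x Hx|x y Hx Hy].
  + have [_ _ iN _] := linear_facts (@sym_injP K L).
    by rewrite !sym_lie_inj lieC iN.
  + by rewrite sl1 sr1 oppr0.
  + by rewrite slD srD Hx Hy opprD.
  + by rewrite slN srN Hx.
  + by rewrite slZ srZ Hx scalerN.
  + by rewrite slM srM Hx Hy !mulrN opprD.
- by rewrite sl1 sr1 oppr0.
- by rewrite slD srD Hx Hy opprD.
- by rewrite slN srN Hx.
- by rewrite slZ srZ Hx scalerN.
- by rewrite slM srM Hx Hy !mulrN opprD.
Qed.

Let slxx (x : S) : sym_lie x x = 0.
Proof.
elim/sym_alg_ind: x => [a||x y Hx Hy|x Hx|c x Hx|x y Hx Hy].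
- have [i0 _ _ _] := linear_facts (@sym_injP K L).
  by rewrite sym_lie_inj liexx i0.
- exact: sl1.
- by rewrite slD !srD Hx Hy add0r addr0 (slC x y) addNr.
- by rewrite slN srN Hx !oppr0.
- by rewrite slZ srZ Hx !scaler0.
- by rewrite slM !srM Hx Hy (slC x y); ring.
Qed.

Let jac (x y z : S) :=
  sym_lie x (sym_lie y z) + sym_lie y (sym_lie z x) + sym_lie z (sym_lie x y).

Let jac_cycle x y z : jac x y z = jac y z x.
Proof. by rewrite /jac; ring. Qed.

Let jacE x y z : jac x y z =
  sym_lie x (sym_lie y z) - sym_lie y (sym_lie x z) - sym_lie (sym_lie x y) z.
Proof. by rewrite /jac (slC z x) srN (slC z (sym_lie x y)). Qed.

Let jac_step y z :
  (forall a, jac (sym_inj a) y z = 0) -> forall x, jac x y z = 0.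
Proof.
move=> H; elim/sym_alg_ind => [//||x x' Hx Hy|x Hx|c x Hx|x x' Hx Hy].
- by rewrite jacE !sl1 sr0 sl0; ring.
- transitivity (jac x y z + jac x' y z); last by rewrite Hx Hy addr0.
  by rewrite !jacE !slD !srD ?slD; ring.
- transitivity (- jac x y z); last by rewrite Hx oppr0.
  by rewrite !jacE !slN !srN ?slN; ring.
- transitivity (c *: jac x y z); last by rewrite Hx scaler0.
  by rewrite !jacE !slZ !srZ ?slZ !scalerBr.
- transitivity (x * jac x' y z + x' * jac x y z).
    by rewrite !jacE !slM !srD ?slD !srM ?slM (slC y x) (slC y x'); ring.
  by rewrite Hx Hy !mulr0 addr0.
Qed.

Let sl_jacobi (x y z : S) : jac x y z = 0.
Proof.
move: x; apply: jac_step => a; rewrite jac_cycle.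
move: y; apply: jac_step => b; rewrite jac_cycle.
move: z; apply: jac_step => c; rewrite jac_cycle.
have [i0 iD _ _] := linear_facts (@sym_injP K L).
by rewrite /jac !sym_lie_inj -!iD lie_jacobi i0.
Qed.

HB.instance Definition _ := isLieAlgebra.Build K S slPl srP slxx sl_jacobi.

Let mulPl (a : K) (x y z : S) : (a *: x + y) * z = a *: (x * z) + y * z.
Proof. by rewrite mulrDl sym_scaleAl. Qed.

HB.instance Definition _ :=
  isPoissonAlgebra.Build K S (@mulrA S) (@mulrC S) (@mul1r S) mulPl slM.

End SymPoisson.

Notation free_poisson K := (sym_alg (free_lie K)).

Definition poisson_var (K : fieldType) (i : nat) : free_poisson K :=
  sym_inj (lie_var K i).

Section PoissonTheory.
Variables (K : fieldType) (A : poissonAlgType K).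
Implicit Types x y z : A.

Lemma pmulPr (a : K) x y z :
  pmul x (a *: y + z) = a *: pmul x y + pmul x z.
Proof. by rewrite pmulC pmulPl !(pmulC _ x). Qed.

Let mullin z : linear (pmul^~ z).
Proof. by move=> a x y; rewrite pmulPl. Qed.
Lemma pmul0l z : pmul 0 z = 0.
Proof. by have [h _ _ _] := linear_facts (mullin z). Qed.
Lemma pmulDl z : {morph pmul^~ z : x y / x + y}.
Proof. by have [_ h _ _] := linear_facts (mullin z). Qed.
Lemma pmulNl x y : pmul (- x) y = - pmul x y.
Proof. by have [_ _ h _] := linear_facts (mullin y); rewrite h. Qed.
Lemma pmulZl (a : K) x y : pmul (a *: x) y = a *: pmul x y.
Proof. by have [_ _ _ h] := linear_facts (mullin y); rewrite h. Qed.
Lemma pmulNr x y : pmul x (- y) = - pmul x y.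
Proof. by rewrite pmulC pmulNl pmulC. Qed.

Lemma leibnizr x y z : lie x (pmul y z) = pmul y (lie x z) + pmul z (lie x y).
Proof. by rewrite lieC leibnizl opprD -!pmulNr -!lieC. Qed.

Lemma lie_pone x : lie pone x = 0.
Proof.
have := leibnizl pone pone x; rewrite !pmul1 => e.
by apply: (addrI (lie pone x)); rewrite addr0 -e.
Qed.
End PoissonTheory.

Section PoissonUniversal.
Variables (K : fieldType) (A : poissonAlgType K).

Section SymLift.
Variables (V : lmodType K) (d : V -> A).
Hypothesis dlin : linear d.

Fixpoint sym_eval (t : sym_term V) : A :=
  match t with
  | SInj v => d v
  | SOne => pone
  | SOpp t => - sym_eval t
  | SAdd s t => sym_eval s + sym_eval t
  | SScale a t => a *: sym_eval t
  | SMul s t => pmul (sym_eval s) (sym_eval t)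
  end.

Lemma sym_eval_cong s t : sym_cong s t -> sym_eval s = sym_eval t.
Proof.
have [d0 dD dN dZ] := linear_facts dlin.
elim=> /=.
- by [].
- by [].
- by move=> s' t' u _ -> _ ->.
- by move=> s' t' _ ->.
- by move=> ? ? ? ? _ -> _ ->.
- by move=> ? ? ? _ ->.
- by move=> ? ? ? ? _ -> _ ->.
- by move=> *; rewrite addrA.
- by move=> *; rewrite addrC.
- by move=> *; rewrite d0 add0r.
- by move=> *; rewrite d0 addNr.
- by move=> *; rewrite scalerA.
- by move=> *; rewrite scale1r.
- by move=> *; rewrite scalerDr.
- by move=> *; rewrite scalerDl.
- by move=> *; rewrite pmulA.
- by move=> *; rewrite pmulC.
- by move=> *; rewrite pmul1.
- by move=> *; rewrite pmulDl.
- by move=> *; rewrite pmulZl.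
- by move=> a v w; rewrite dlin.
Qed.

Lemma sym_alg_lift :
  exists h : sym_alg V -> A, [/\ linear h, h 1 = pone,
    forall x y, h (x * y) = pmul (h x) (h y) & forall v, h (sym_inj v) = d v].
Proof.
pose h (x : sym_alg V) := sym_eval (repr x).
have hE t : h (scls t) = sym_eval t.
  by apply: sym_eval_cong; apply/sclsP; rewrite /scls reprK.
exists h; split.
- move=> a; elim/scls_ind=> s; elim/scls_ind=> t.
  by rewrite -sclsZ -sclsD !hE.
- by rewrite -scls1 hE.
- by elim/scls_ind=> s; elim/scls_ind=> t; rewrite -sclsM !hE.
- by move=> v; rewrite hE.
Qed.
End SymLift.

Lemma free_poisson_universal (x : nat -> A) :
  exists! h : free_poisson K -> A,
    poisson_hom h /\ forall i, h (poisson_var K i) = x i.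
Proof.
have [g [[[glin gbr] gx] guniq]] := free_lie_universal (x : nat -> A).
have [h [hlin h1 hM hi]] := sym_alg_lift glin.
have [h0 hD hN hZ] := linear_facts hlin.
have lie1 (p : free_poisson K) : lie (1 : free_poisson K) p = 0.
  exact: (lie_pone p).
have lie1' (p : A) : lie p pone = 0 by rewrite lieC lie_pone oppr0.
have lieN (B : poissonAlgType K) (p q : B) : lie (- p) q = - lie p q.
  by rewrite -scaleN1r lieZl scaleN1r.
have lieN' (B : poissonAlgType K) (p q : B) : lie p (- q) = - lie p q.
  by rewrite -scaleN1r lieZr scaleN1r.
have hlie p q : h (lie p q) = lie (h p) (h q).
  elim/sym_alg_ind: p => [a||y z Hy Hz|y Hy|c y Hy|y z Hy Hz].
  - elim/sym_alg_ind: q => [b||y z Hy Hz|y Hy|c y Hy|y z Hy Hz].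
    + by rewrite [lie _ _]sym_lie_inj !hi gbr.
    + by rewrite h1 lie1' [lie _ _]lieC hN lie1 h0 oppr0.
    + by rewrite lieDr !hD Hy Hz lieDr.
    + by rewrite lieN' !hN Hy lieN'.
    + by rewrite lieZr !hZ Hy lieZr.
    + have -> : lie (sym_inj a) (y * z) =
          y * lie (sym_inj a) z + z * lie (sym_inj a) y.
        exact: leibnizr.
      by rewrite hD !hM Hy Hz leibnizr.
  - by rewrite lie1 h1 lie_pone h0.
  - by rewrite lieDl !hD Hy Hz lieDl.
  - by rewrite lieN !hN Hy lieN.
  - by rewrite lieZl !hZ Hy lieZl.
  - have -> : lie (y * z) q = y * lie z q + z * lie y q by exact: leibnizl.
    by rewrite hD !hM Hy Hz leibnizl.
exists h; split; first by split=> // i; rewrite hi gx.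
move=> k [[klin k1 kM klie] kx]; have [k0 kD kN kZ] := linear_facts klin.
have gk : g = (fun v => k (sym_inj v)).
  apply: guniq; split=> //; split.
    by move=> a u v; rewrite sym_injP klin.
  by move=> u v; rewrite -klie [lie (sym_inj _) _]sym_lie_inj.
apply/funext; elim/sym_alg_ind => [a||y z Hy Hz|y Hy|c y Hy|y z Hy Hz].
- by rewrite hi gk.
- by rewrite h1 -k1.
- by rewrite hD kD Hy Hz.
- by rewrite hN kN Hy.
- by rewrite hZ kZ Hy.
- by rewrite hM Hy Hz -kM.
Qed.
End PoissonUniversal.

Section Variety.
Variable K : fieldType.
Local Notation F := (free_poisson K).

Definition satisfies (A : poissonAlgType K) (f : F) : Prop :=
  forall h : F -> A, poisson_hom h -> h f = 0.

Definition is_variety (W : poissonAlgType K -> Prop) : Prop :=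
  exists S : set F, forall A, W A <-> (forall f, S f -> satisfies A f).

Definition identities (W : poissonAlgType K -> Prop) : set F :=
  [set f | forall A, W A -> satisfies A f].

Variable W : poissonAlgType K -> Prop.
Let I := identities W.

Let I0 : I 0.
Proof. by move=> A _ h [hl _ _ _]; have [h0 _ _ _] := linear_facts hl. Qed.
Let IP (a : K) x y : I x -> I y -> I (a *: x + y).
Proof.
by move=> Ix Iy A WA h hh; have [hl _ _ _] := hh;
  rewrite hl (Ix A WA) // (Iy A WA) // scaler0 addr0.
Qed.
Let IM x y : I y -> I (x * y).
Proof.
move=> Iy A WA h hh; have [_ _ hM _] := hh.
by rewrite [LHS]hM (Iy A WA) // pmulC pmul0l.
Qed.
Let Ilie x y : I y -> I (lie x y).
Proof.
by move=> Iy A WA h hh; have [_ _ _ hl] := hh;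
  rewrite hl (Iy A WA) // lie0r.
Qed.
Let IZ a x : I x -> I (a *: x).
Proof. by move=> Ix; rewrite -[_ *: _]addr0; exact: IP. Qed.
Let IN x : I x -> I (- x).
Proof. by rewrite -scaleN1r; exact: IZ. Qed.
Let ID x y : I x -> I y -> I (x + y).
Proof. by move=> Ix Iy; rewrite -[x]scale1r; exact: IP. Qed.

Definition var_cong (x y : F) : bool := `[< I (x - y) >].

Lemma var_cong_equiv : equiv_class_of var_cong.
Proof.
split=> [x|x y|y x z]; rewrite /var_cong.
- by apply/asboolP; rewrite subrr.
- by apply/asboolP/asboolP => /IN; rewrite opprB.
- move=> /asboolP xy /asboolP yz; apply/asboolP.
  by have := ID xy yz; rewrite addrA subrK.
Qed.
Canonical var_cong_equivRel := EquivRelPack var_cong_equiv.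

(* F(W, X) = F(X) / Id(W) *)
Definition relfree : Type := {eq_quot var_cong}.
HB.instance Definition _ : EqQuotient _ var_cong relfree :=
  EqQuotient.on relfree.
HB.instance Definition _ := Choice.on relfree.

Definition relfree_pi (x : F) : relfree := \pi_relfree x.
Local Notation pi := relfree_pi.
Let rp (x : relfree) : F := repr x.

Lemma relfree_piP x y : pi x = pi y <-> I (x - y).
Proof.
split; first by move=> /eqmodP; rewrite /var_cong /= => /asboolP.
by move=> xy; apply/eqmodP/asboolP.
Qed.
Lemma relfree_ind (P : relfree -> Prop) : (forall t, P (pi t)) -> forall x, P x.
Proof. by move=> h; elim/quotW. Qed.
Let rpP x : I (rp (pi x) - x).
Proof. by apply/relfree_piP; rewrite /relfree_pi /rp reprK. Qed.

Let add x y := pi (rp x + rp y).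
Let opp x := pi (- rp x).
Let scale (a : K) x := pi (a *: rp x).
Let mul x y := pi (rp x * rp y).
Let br x y := pi (lie (rp x) (rp y)).

Let addE x y : add (pi x) (pi y) = pi (x + y).
Proof. by apply/relfree_piP; rewrite opprD addrACA; apply: ID; exact: rpP. Qed.
Let oppE x : opp (pi x) = pi (- x).
Proof. by apply/relfree_piP; rewrite -opprD; apply: IN; exact: rpP. Qed.
Let scaleE a x : scale a (pi x) = pi (a *: x).
Proof. by apply/relfree_piP; rewrite -scalerBr; apply: IZ; exact: rpP. Qed.
Let mulE x y : mul (pi x) (pi y) = pi (x * y).
Proof.
apply/relfree_piP; set x' := rp _; set y' := rp _.
have -> : x' * y' - x * y = x' * (y' - y) + y * (x' - x) by ring.
by apply: ID; apply: IM; exact: rpP.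
Qed.
Let brE x y : br (pi x) (pi y) = pi (lie x y).
Proof.
apply/relfree_piP; set x' := rp _; set y' := rp _.
have -> : lie x' y' - lie x y = lie x' (y' - y) - lie y (x' - x).
  by rewrite !lieDr !lieNr (lieC y x') (lieC y x) !opprD !opprK addrA subrK.
apply: ID; first by apply: Ilie; exact: rpP.
by apply: IN; apply: Ilie; exact: rpP.
Qed.

Let addA : associative add.
Proof.
elim/relfree_ind=> x; elim/relfree_ind=> y; elim/relfree_ind=> z.
by rewrite !addE addrA.
Qed.
Let addC : commutative add.
Proof.
by elim/relfree_ind=> x; elim/relfree_ind=> y; rewrite !addE addrC.
Qed.
Let add0 : left_id (pi 0) add.
Proof. by elim/relfree_ind=> x; rewrite addE add0r. Qed.
Let addN : left_inverse (pi 0) opp add.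
Proof. by elim/relfree_ind=> x; rewrite oppE addE addNr. Qed.
HB.instance Definition _ := GRing.isZmodule.Build relfree addA addC add0 addN.

Let addE' x y : pi x + pi y = pi (x + y).
Proof. exact: addE. Qed.

Let scaleA a b x : scale a (scale b x) = scale (a * b) x.
Proof. by elim/relfree_ind: x => x; rewrite !scaleE scalerA. Qed.
Let scale1 : left_id 1 scale.
Proof. by elim/relfree_ind=> x; rewrite scaleE scale1r. Qed.
Let scaleDr : right_distributive scale +%R.
Proof.
move=> a; elim/relfree_ind=> x; elim/relfree_ind=> y.
by rewrite addE' !scaleE addE' scalerDr.
Qed.
Let scaleDl x : {morph scale^~ x : a b / a + b}.
Proof. by elim/relfree_ind: x => x a b; rewrite !scaleE addE' scalerDl. Qed.
HB.instance Definition _ := GRing.Zmodule_isLmodule.Build K relfree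
  scaleA scale1 scaleDr scaleDl.

Let scaleE' a x : a *: pi x = pi (a *: x).
Proof. exact: scaleE. Qed.

Let brPl (a : K) (x y z : relfree) : br (a *: x + y) z = a *: br x z + br y z.
Proof.
elim/relfree_ind: x => x; elim/relfree_ind: y => y; elim/relfree_ind: z => z.
by rewrite (brE x z) (brE y z) !scaleE' !addE' brE liePl.
Qed.
Let brPr (a : K) (x y z : relfree) : br x (a *: y + z) = a *: br x y + br x z.
Proof.
elim/relfree_ind: x => x; elim/relfree_ind: y => y; elim/relfree_ind: z => z.
by rewrite (brE x y) (brE x z) !scaleE' !addE' brE liePr.
Qed.
Let brxx (x : relfree) : br x x = 0.
Proof. by elim/relfree_ind: x => x; rewrite brE liexx. Qed.
Let br_jacobi (x y z : relfree) :
  br x (br y z) + br y (br z x) + br z (br x y) = 0.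
Proof.
elim/relfree_ind: x => x; elim/relfree_ind: y => y; elim/relfree_ind: z => z.
by rewrite !brE !addE' lie_jacobi.
Qed.
HB.instance Definition _ :=
  isLieAlgebra.Build K relfree brPl brPr brxx br_jacobi.

Let mulA : associative mul.
Proof.
elim/relfree_ind=> x; elim/relfree_ind=> y; elim/relfree_ind=> z.
by rewrite !mulE mulrA.
Qed.
Let mulC : commutative mul.
Proof.
by elim/relfree_ind=> x; elim/relfree_ind=> y; rewrite !mulE mulrC.
Qed.
Let mul1 : left_id (pi 1) mul.
Proof. by elim/relfree_ind=> x; rewrite mulE mul1r. Qed.
Let mulPl (a : K) (x y z : relfree) :
  mul (a *: x + y) z = a *: mul x z + mul y z.
Proof.
elim/relfree_ind: x => x; elim/relfree_ind: y => y; elim/relfree_ind: z => z.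
by rewrite (mulE x z) (mulE y z) !scaleE' !addE' mulE mulrDl sym_scaleAl.
Qed.
Let leib (x y z : relfree) :
  lie (mul x y) z = mul x (lie y z) + mul y (lie x z).
Proof.
elim/relfree_ind: x => x; elim/relfree_ind: y => y; elim/relfree_ind: z => z.
rewrite mulE [lie _ _]brE [lie (pi y) _]brE [lie (pi x) _]brE !mulE addE'.
by congr pi; exact: leibnizl.
Qed.
HB.instance Definition _ :=
  isPoissonAlgebra.Build K relfree mulA mulC mul1 mulPl leib.

Lemma relfree_pi_hom : poisson_hom pi.
Proof.
split=> [a x y||x y|x y].
- by rewrite scaleE' addE'.
- by [].
- by symmetry; exact: mulE.
- by symmetry; exact: brE.
Qed.

Lemma relfree_universal (A : poissonAlgType K) (x : nat -> A) : W A ->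
  exists! h : relfree -> A,
    poisson_hom h /\ forall i, h (pi (poisson_var K i)) = x i.
Proof.
move=> WA.
have [k [[kh kx] kuniq]] := free_poisson_universal x.
have [klin k1 kM kl] := kh; have [k0 kD kN kZ] := linear_facts klin.
have hE t : k (rp (pi t)) = k t.
  by apply/eqP; rewrite -subr_eq0 -kN -kD (rpP t WA).
exists (fun y => k (rp y)); split.
  split; last by move=> i; rewrite hE.
  split=> [a|||].
  - by elim/relfree_ind=> s; elim/relfree_ind=> t; rewrite scaleE' addE' !hE klin.
  - exact: etrans (hE 1) k1.
  - by elim/relfree_ind=> s; elim/relfree_ind=> t;
      rewrite -[pmul _ _]/(mul _ _) mulE !hE; exact: kM.
  - by elim/relfree_ind=> s; elim/relfree_ind=> t; rewrite -[lie _ _]/(br _ _) brE !hE kl.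
move=> g [[glin g1 gM gl] gx].
have kE : k = g \o pi.
  have [plin p1 pM pl] := relfree_pi_hom.
  apply: kuniq; split=> //; split=> [a s t|||].
  - by rewrite /= plin glin.
  - by rewrite /= p1.
  - by move=> s t; rewrite /= pM gM.
  - by move=> s t; rewrite /= pl gl.
by apply/funext; elim/relfree_ind => t; rewrite hE kE.
Qed.

Lemma relfree_in_variety : is_variety W -> W relfree.
Proof.
move=> [S WS]; apply/WS => f Sf h hh.
pose p i : F := repr (h (poisson_var K i)).
have [e [[eh ex] _]] := free_poisson_universal p.
have [elin e1 eM el] := eh.
have [plin p1 pM pl] := relfree_pi_hom.
have [u [_ uuniq]] :=
  free_poisson_universal (fun i => h (poisson_var K i)).
have hE : h = pi \o e.
  transitivity u; [symmetry|]; apply: uuniq; split=> //.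
    split=> [a s t|||].
    - by rewrite /= elin plin.
    - by rewrite /= e1 p1.
    - by move=> s t; rewrite /= eM pM.
    - by move=> s t; rewrite /= el pl.
  by move=> i; rewrite /= ex /relfree_pi /p reprK.
rewrite hE /=; have -> : 0 = pi 0 by [].
apply/relfree_piP; rewrite subr0 => A WA k kh.
have [klin k1 kM kl] := kh.
have /(_ (k \o e)) := (WS A).1 WA f Sf; apply.
split=> [a s t|||].
- by rewrite /= elin klin.
- by rewrite /= e1.
- by move=> s t; rewrite /= eM kM.
- by move=> s t; rewrite /= el kl.
Qed.

End Variety.

Inductive commutator : Type :=
| CX of nat
| CBr of commutator & commutator.

Fixpoint letters (w : commutator) : seq nat :=
  match w with CX i => [:: i] | CBr u v => letters u ++ letters v end.

Section Codimension.
Variable K : fieldType.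

Fixpoint comm_val (w : commutator) : free_lie K :=
  match w with CX i => lie_var K i | CBr u v => lie (comm_val u) (comm_val v) end.

Definition lie_degree_le (d : nat) : set (free_lie K) :=
  lspan [set comm_val w | w in [set w | (size (letters w) <= d)%N]].

(* [f] need not be homogeneous: [d] is the degree of its top component. *)
Definition has_lie_degree (f : free_lie K) (d : nat) : Prop :=
  lie_degree_le d f /\ forall e, lie_degree_le e f -> (d <= e)%N.

Definition mon_val (s : seq commutator) : free_poisson K :=
  \prod_(w <- s) sym_inj (comm_val w).

(* Each of X_1, ..., X_n occurs exactly once, and no other variable does. *)
Definition multilinear (n : nat) : set (seq commutator) :=
  [set s | perm_eq (flatten [seq letters w | w <- s]) (iota 1 n)].

Definition multilinear_part (n : nat) : set (free_poisson K) :=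
  lspan [set mon_val s | s in multilinear n].

Definition codim (W : poissonAlgType K -> Prop) (n : nat) : nat :=
  dimension [set relfree_pi W f | f in multilinear_part n].

Lemma codim_has_dim (W : poissonAlgType K -> Prop) (n : nat) :
  has_dim [set relfree_pi W f | f in multilinear_part n] (codim W n).
Proof.
rewrite /codim; suff fin : finite_set (multilinear n).
  have -> : [set relfree_pi W f | f in multilinear_part n] =
      lspan [set relfree_pi W (mon_val s) | s in multilinear n].
    have [plin _ _ _] := relfree_pi_hom W.
    have [p0 pD _ pZ] := linear_facts plin.
    have psum (s : seq (K * free_poisson K)) :
        relfree_pi W (\sum_(p <- s) p.1 *: p.2) =
        \sum_(p <- [seq (p.1, relfree_pi W p.2) | p <- s]) p.1 *: p.2.
      elim: s => [|p s IH]; first by rewrite /= !big_nil p0.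
      by rewrite /= !big_cons -IH plin.
    apply/seteqP; split=> v.
      move=> [_ [s [sG ->]] <-]; rewrite psum; eexists; split; last by [].
      by move=> _ /mapP[p ps ->] /=; have [t nt <-] := sG p ps; exists t.
    move=> [s [sG ->]]; elim: s sG => [|[c w] s IH] sG.
      exists 0; last by rewrite big_nil p0.
      by exists [::]; rewrite big_nil.
    have [_ [s' [s'G ->]] fE] : [set relfree_pi W f | f in multilinear_part n]
        (\sum_(p <- s) p.1 *: p.2).
      by apply: IH => p ps; apply: sG; rewrite inE ps orbT.
    have [t nt /= tE] := sG (c, w) (mem_head _ _).
    exists (c *: mon_val t + \sum_(p <- s') p.1 *: p.2); last first.
      by rewrite big_cons plin fE tE.
    exists ((c, mon_val t) :: s'); split; last by rewrite big_cons.
    by move=> p; rewrite inE => /orP[/eqP ->|/s'G //]; exists t.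
  have [d dP] := finite_span_has_dim
      (finite_image (fun s => relfree_pi W (mon_val s)) fin).
    exact: has_dim_dimension dP.
have letters_gt0 w : (0 < size (letters w))%N.
  by elim: w => //= u IHu v _; rewrite size_cat ltn_addr.
pose T d := [set w | (size (letters w) <= d)%N /\
                     forall i, i \in letters w -> (i <= n)%N].
have finT d : finite_set (T d).
  elim: d => [|d IH].
    by apply: (sub_finite_set _ (finite_set0 _)) => w [];
      rewrite leqNgt letters_gt0.
  have : finite_set ([set CX i | i in `I_n.+1] `|`
      [set CBr p.1 p.2 | p in T d `*` T d]).
    rewrite finite_setU; split; first exact: finite_image.
    by apply: finite_image; exact: finite_setX.
  apply: sub_finite_set => -[i|u v] [/= sz le].
    by left; exists i => //=; rewrite ltnS le ?mem_head.
  right; exists (u, v) => //; move: sz; rewrite size_cat => sz; split; split=> /=.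
  - by rewrite -ltnS (leq_trans _ sz) // -addn1 leq_add2l letters_gt0.
  - by move=> i iu; apply: le; rewrite mem_cat iu.
  - by rewrite -ltnS (leq_trans _ sz) // -add1n leq_add2r letters_gt0.
  - by move=> i iv; apply: le; rewrite mem_cat iv orbT.
pose Q d := [set s : seq commutator |
  (size s <= d)%N /\ forall i, (i < size s)%N -> T n (nth (CX 0) s i)].
have finQ d : finite_set (Q d).
  elim: d => [|d IH].
    apply: (sub_finite_set _ (finite_set1 [::])) => s [/=].
    by rewrite leqn0 => /eqP/size0nil ->.
  have : finite_set ([set [::]] `|` [set p.1 :: p.2 | p in T n `*` Q d]).
    rewrite finite_setU; split; first exact: finite_set1.
    by apply: finite_image; exact: finite_setX.
  apply: sub_finite_set => -[|w s] [/= sz le]; first by left.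
  right; exists (w, s) => //; split=> /=; first exact: (le 0%N).
  by split=> // i i_s; exact: (le i.+1).
apply: (sub_finite_set _ (finQ n)) => s /= ns.
have szn : size (flatten [seq letters w | w <- s]) = n.
  by rewrite (perm_size ns) size_iota.
have len i : i \in flatten [seq letters w | w <- s] -> (i <= n)%N.
  by rewrite (perm_mem ns) mem_iota add1n ltnS => /andP[].
have sub (t : seq commutator) : (forall i, (i < size t)%N ->
    (size (letters (nth (CX 0) t i)) <=
       size (flatten [seq letters w | w <- t]))%N /\
    {subset letters (nth (CX 0) t i) <=
       flatten [seq letters w | w <- t]}).
  elim: t => // w t IH [|i] /= it; rewrite size_cat.
    by split=> [|j jw]; rewrite ?leq_addr // mem_cat jw.
  have [h1 h2] := IH i it; split=> [|j /h2 jt].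
    by rewrite (leq_trans h1) // leq_addl.
  by rewrite mem_cat jt orbT.
split=> [|i it]; last first.
  have [h1 h2] := sub s i it; split=> [|j /h2 /len //].
  by rewrite -[X in (_ <= X)%N]szn.
rewrite -szn; elim: (s) => //= w t IH.
by rewrite size_cat -add1n leq_add // letters_gt0.
Qed.

End Codimension.

Section PowerSeries.
Variable R : realType.
Implicit Types a b : nat -> R.

Definition fps_one : nat -> R := fun n => (n == 0%N)%:R.
Definition fps_X : nat -> R := fun n => (n == 1%N)%:R.
Definition fps_mul a b : nat -> R := fun n => \sum_(i < n.+1) a i * b (n - i)%N.
Definition fps_pow a (k : nat) : nat -> R := iter k (fps_mul a) fps_one.

(* sum_k a^k / k!, for a series a without constant term: the coefficient of z^n
   in a^k is then 0 for k > n. *)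
Definition fps_exp a : nat -> R :=
  fun n => \sum_(k < n.+1) fps_pow a k n / k`!%:R.

Definition fps_le a b : Prop := forall n, a n <= b n.

Fixpoint exp_tower (k : nat) : nat -> R :=
  if k is j.+1 then fps_exp (fps_mul fps_X (exp_tower j)) else fps_exp fps_X.

(* exp(z exp(z ... exp(z))) with m - 1 exponentials, for m >= 2 *)
Definition q_tilde (m : nat) : nat -> R := exp_tower (m - 2).

Definition complexity (K : fieldType) (W : poissonAlgType K -> Prop) : nat -> R :=
  fun n => (codim W n)%:R / n`!%:R.

(* [ln x] is 0 for x <= 0, so this is the iterated logarithm only for large x. *)
Definition iter_ln (k : nat) (x : R) : R := iter k (@ln R) x.

End PowerSeries.

(* Main.v *)
Require Import Defs.
From HB Require Import structures.
From mathcomp Require Import all_boot all_order all_algebra.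
From mathcomp Require Import ring lra zify.
From mathcomp Require Import all_classical all_reals all_analysis.
From Stdlib Require Cantor.
Set Implicit Arguments.
Unset Strict Implicit.
Unset Printing Implicit Defensive.
Import Order.TTheory GRing.Theory Num.Theory.
Import numFieldNormedType.Exports.
Local Open Scope classical_set_scope.
Local Open Scope ring_scope.

(** Order the variables and write [a, v] for the left-normed commutator of a letter
[a] with the letters of a word [v].  By anticommutativity and Jacobi, every
multilinear monomial of P_n is a combination of products of such commutators,
one for each block of a set partition of 1, ..., n, where [a] is the least letter
of its block.  The identity is used to shrink the set of words [v] that occur.

A nonzero identity of degree m has a nonzero multilinear consequence of the same
degree ([left_normed_identity]), which reads

  [y_0, y_1, ..., y_(m-1)] = sum over sigma <> 1 of c_sigma [y_0, y_sigma(1), ...].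

Over a finite field this rests on the embedding of the free Lie algebra in the
free associative algebra: some associative word w of length m occurs in f
([top_word]); substituting for X_i the sum of the y_j with w_j = i and keeping,
by inclusion-exclusion, the part that involves every y_j makes the coefficient
of y_1 ... y_m equal to that of w.  The embedding itself is [lie_null_eq0],
proved by Lazard elimination.

Call a_1 v_1 a_2 v_2 ... a_k v_k a chain when each a_i is less than every letter
to its right.  If a word contains a chain with m - 1 heads, apply the identity to
y_i = [a_i, v_i].  The lexicographically least word of the product y_1 ... y_(m-1)
is the chain itself, and permuting the factors only produces larger words; so
the word is a combination of larger ones, and words without such a chain suffice
([act_span_no_chain]).

Those words are easily counted.  Cut a word with distinct letters at its least
letter [a], as u a v.  A chain with k heads in v extends to one with k + 1 heads
in a v ([has_chain_min]), so if u a v has no chain with k + 1 heads then neither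
has u, and v has none with k heads.  Hence the exponential generating functions
N_k of these words satisfy N_(k+1)' <= N_(k+1) N_k with N_0 = 1, and so are bounded
by E_0 = 1, E_(k+1) = exp(z E_k), because
E_(k+1)' = (E_k + z E_k') E_(k+1) >= E_k E_(k+1) ([exp_iter_conv]).  Splitting off
the block of the least letter, the spanning products for P_n obey the same
recursion and are counted by one more exponential
([codim_le_size_poisson_gens], [size_poisson_gens]).  This is the first part.

For the second part, E_(k+1) has nonnegative coefficients, so its n-th coefficient
is at most E_(k+1)(r) / r^n for every r > 0.  Take r = t ln^(k) n with t < 1: then
E_k(r) r is eventually less than c n for every c > 0, the iterated
exponential undoing the iterated logarithm with room to spare
([exp_val_iter_ln_step]), and letting t tend to 1 gives the bound. *)

(** * Linear spans *)

Section Span.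
Variables (K : fieldType).
Implicit Types U V : lmodType K.

Lemma lspan0 V (G : set V) : lspan G 0.
Proof. by exists [::]; rewrite big_nil. Qed.

Lemma lspanP V (G : set V) a x y : lspan G x -> lspan G y -> lspan G (a *: x + y).
Proof.
move=> [s [sG ->]] [t [tG ->]].
exists ([seq (a * p.1, p.2) | p <- s] ++ t); split.
  by move=> p; rewrite mem_cat => /orP[/mapP[q qs ->]|/tG //]; exact: (sG q).
rewrite big_cat big_map /= scaler_sumr; congr (_ + _).
by apply: eq_bigr => p _; rewrite scalerA.
Qed.

Lemma lspan_gen V (G : set V) x : G x -> lspan G x.
Proof.
move=> Gx; exists [:: (1, x)]; rewrite big_seq1 scale1r; split=> // p.
by rewrite inE => /eqP ->.
Qed.

Lemma lspanZ V (G : set V) a x : lspan G x -> lspan G (a *: x).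
Proof. by move=> Gx; rewrite -[_ *: _]addr0; apply: lspanP => //; exact: lspan0. Qed.

Lemma lspanD V (G : set V) x y : lspan G x -> lspan G y -> lspan G (x + y).
Proof. by move=> Gx Gy; rewrite -[x]scale1r; exact: lspanP. Qed.

Lemma lspanB V (G : set V) x y : lspan G x -> lspan G y -> lspan G (x - y).
Proof. by move=> Gx Gy; rewrite addrC -scaleN1r; exact: lspanP. Qed.

Lemma lspan_sum V (G : set V) (I : eqType) (r : seq I) (F : I -> V) :
  (forall i, i \in r -> lspan G (F i)) -> lspan G (\sum_(i <- r) F i).
Proof.
elim: r => [|i r IH] h; first by rewrite big_nil; exact: lspan0.
rewrite big_cons; apply: lspanD; first by apply: h; rewrite mem_head.
by apply: IH => j jr; apply: h; rewrite inE jr orbT.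
Qed.

Lemma lspan_ind V (G : set V) (P : V -> Prop) :
  P 0 -> (forall a g v, G g -> lspan G v -> P v -> P (a *: g + v)) ->
  forall v, lspan G v -> P v.
Proof.
move=> P0 PS v [s [sG ->]]; elim: s sG => [|p s IH] sG; first by rewrite big_nil.
have sG' q : q \in s -> G q.2 by move=> qs; apply: sG; rewrite inE qs orbT.
rewrite big_cons; apply: PS; [by apply: sG; rewrite mem_head| |exact: IH].
by exists s.
Qed.

Lemma lspan_map U V (f : U -> V) (G : set U) (H : set V) : linear f ->
  (forall g, G g -> lspan H (f g)) -> forall v, lspan G v -> lspan H (f v).
Proof.
move=> flin GH; have [f0 _ _ _] := linear_facts flin.
apply: lspan_ind => [|a g v Gg _ IH]; first by rewrite f0; exact: lspan0.
by rewrite flin; apply: lspanP => //; exact: GH.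
Qed.

Lemma lspan_sub V (G H : set V) :
  (forall g, G g -> lspan H g) -> forall v, lspan G v -> lspan H v.
Proof. exact: (@lspan_map V V id). Qed.

Lemma lspan_mono V (G H : set V) : G `<=` H -> lspan G `<=` lspan H.
Proof. by move=> GH v; apply: lspan_sub => g /GH; exact: lspan_gen. Qed.

(** A family longer than [G] has a coordinate matrix with more rows than columns,
    whose left kernel gives a linear relation. *)
Lemma lspan_lfree_le V d (b : 'I_d -> V) (G : seq V) :
  lfree b -> (forall i, lspan [set` G] (b i)) -> (d <= size G)%N.
Proof.
move=> bfree bG.
have bE i : exists a : 'I_(size G) -> K, b i = \sum_j a j *: G`_j.
  apply/lspan_rangeP; apply: lspan_mono (bG i) => v /= /(nthP 0)[j jG <-].
  by exists (Ordinal jG).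
have /choice[M ME] := bE.
pose A := \matrix_(i, j) M i j : 'M[K]_(d, size G).
rewrite leqNgt; apply/negP => ltd.
have : kermx A != 0.
  rewrite -mxrank_eq0 mxrank_ker -lt0n subn_gt0.
  exact: leq_ltn_trans (rank_leq_col A) ltd.
case/rowV0Pn => u /sub_kermxP uA /negP[]; apply/eqP/rowP => i; rewrite mxE.
apply: bfree; under eq_bigr do rewrite ME scaler_sumr.
rewrite exchange_big /= big1 // => j _.
under eq_bigr do rewrite scalerA; rewrite -scaler_suml.
have /rowP/(_ j) := uA; rewrite !mxE => uj.
by rewrite (_ : \sum_(_ < d) _ = 0) ?scale0r // -[RHS]uj; apply: eq_bigr => k _; rewrite mxE.
Qed.

End Span.

(** * The free Lie algebra acts faithfully *)

Lemma size_letters_gt0 w : (0 < size (letters w))%N.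
Proof. by elim: w => //= u IHu v _; rewrite size_cat ltn_addr. Qed.

Lemma lie_lie (K : fieldType) (L : lieAlgType K) (t u v : L) :
  lie t (lie u v) = lie (lie t u) v - lie (lie t v) u.
Proof.
have := lie_jacobi t u v; rewrite (lieC v (lie t u)) (lieC u (lie v t)).
by rewrite (lieC v t) lieNl opprK => /eqP; rewrite subr_eq0 => /eqP <-; rewrite addrK.
Qed.

Section Operators.
Variables (K : fieldType) (V : lmodType K) (X : nat -> V -> V).

(** Arbitrary maps [V -> V] do not form a Lie algebra under the commutator, so the
    representation attached to linear operators [X i] is built on terms and then
    shown to respect the congruence. *)
Fixpoint term_op (t : lie_term K) (v : V) : V :=
  match t with
  | LVar i => X i v
  | LZero => 0
  | LOpp t => - term_op t v
  | LAdd s t => term_op s v + term_op t v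
  | LScale a t => a *: term_op t v
  | LBr s t => term_op s (term_op t v) - term_op t (term_op s v)
  end.

Definition lie_op (g : free_lie K) : V -> V := term_op (repr g).

Hypothesis Xlin : forall i, linear (X i).

Lemma term_op_lin t : linear (term_op t).
Proof.
elim: t => /= [i|a u v|t IH|s IHs t IHt|b t IH|s IHs t IHt] //.
- by rewrite scaler0 addr0.
- by move=> a u v; rewrite IH opprD scalerN.
- by move=> a u v; rewrite IHs IHt scalerDr addrACA.
- by move=> a u v; rewrite IH scalerDr !scalerA mulrC.
- by move=> a u v; rewrite IHt !IHs IHt opprD scalerBr addrACA.
Qed.

Lemma term_op_cong s t : lie_cong s t -> term_op s =1 term_op t.
Proof.
have L t' := linear_facts (@term_op_lin t').
elim=> /=.
- by [].
- by move=> s' t' _ IH v; rewrite IH.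
- by move=> s' t' u _ IH1 _ IH2 v; rewrite IH1 IH2.
- by move=> s' t' _ IH v; rewrite IH.
- by move=> s' t' u w _ IH1 _ IH2 v; rewrite IH1 IH2.
- by move=> a s' t' _ IH v; rewrite IH.
- by move=> s' t' u w _ IH1 _ IH2 v; rewrite !IH1 !IH2.
- by move=> * ? /=; rewrite addrA.
- by move=> * ? /=; rewrite addrC.
- by move=> * ? /=; rewrite add0r.
- by move=> * ? /=; rewrite addNr.
- by move=> * ? /=; rewrite scalerA.
- by move=> * ? /=; rewrite scale1r.
- by move=> * ? /=; rewrite scalerDr.
- by move=> * ? /=; rewrite scalerDl.
- move=> a s' t' u v; have [_ uD _ uZ] := L u.
  by rewrite uD uZ opprD scalerBr addrACA.
- move=> a s' t' u v; have [_ sD _ sZ] := L s'.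
  by rewrite sD sZ opprD scalerBr addrACA.
- by move=> t' v; rewrite subrr.
- move=> s' t' u v; have [_ sD sN _] := L s'.
  have [_ tD tN _] := L t'; have [_ uD uN _] := L u.
  rewrite !sD !tD !uD !sN !tN !uN !opprD !opprK.
  rewrite (AC ((2*2)*(2*2)*(2*2)) ((1*11)*(2*8)*(3*5)*(4*10)*(6*12)*(7*9))) /=.
  by rewrite !subrr !addNr !addr0.
Qed.

Lemma lie_opE t : lie_op (lcls t) =1 term_op t.
Proof. by apply: term_op_cong; apply/lclsP; rewrite /lcls reprK. Qed.

Lemma lie_op_lin g : linear (lie_op g).
Proof. exact: term_op_lin. Qed.

Lemma lie_opP v : linear (fun g => lie_op g v).
Proof.
move=> a; elim/lcls_ind=> s; elim/lcls_ind=> t.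
by rewrite -lclsZ -lclsD !lie_opE.
Qed.

Lemma lie_op_lie g h v :
  lie_op (lie g h) v = lie_op g (lie_op h v) - lie_op h (lie_op g v).
Proof.
elim/lcls_ind: g => s; elim/lcls_ind: h => t.
by rewrite -lcls_lie !lie_opE.
Qed.

Lemma lie_op_var i : lie_op (lie_var K i) =1 X i.
Proof. exact: lie_opE. Qed.

End Operators.

(** Lazard elimination of X_a: the ideal of L(X) generated by the other variables is
    generated as a Lie algebra by the y_(i,j) = (ad X_a)^i X_j, and has codimension
    one.  The pair (i, j) is coded by a natural number and [bump a j] runs
    over the variables other than X_a; [phi] maps the free Lie algebra on the
    y_(i,j) to L(X).  The only use of the elimination is an induction on degree: a commutator that
    involves X_a has smaller degree in the y_(i,j). *)
Section Elimination.
Variables (K : fieldType) (a : nat).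
Local Notation L := (free_lie K).
Local Notation xa := (lie_var K a).

Definition elim_var (k : nat) : L :=
  let: (i, j) := Cantor.of_nat k in iter i (lie xa) (lie_var K (bump a j)).

Variables (phi : L -> L).
Hypotheses (phi_hom : lie_hom phi) (phi_var : forall k, phi (lie_var K k) = elim_var k).

Lemma lie_degree_le_mono d e : (d <= e)%N -> @lie_degree_le K d `<=` @lie_degree_le K e.
Proof.
move=> de; apply: lspan_mono => _ [w /= wd <-]; exists w => //=.
exact: leq_trans de.
Qed.

Lemma lie_degree_le_lie d e (g h : L) : lie_degree_le d g -> lie_degree_le e h ->
  lie_degree_le (d + e) (lie g h).
Proof.
move=> gd he; move: g gd.
apply: (lspan_map (f := fun g => lie g h)) => [c x y|_ [u /= ud <-]].
  by rewrite liePl.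
move: h he; apply: lspan_map => [c x y|_ [v /= vd <-]]; first by rewrite liePr.
by apply: lspan_gen; exists (CBr u v) => //=; rewrite size_cat leq_add.
Qed.

(** The derivation ad X_a acts on the y_(i,j) by i |-> i + 1, hence preserves the
    degree in them. *)
Lemma elim_shift w : exists2 h, lie_degree_le (size (letters w)) h &
  phi h = lie xa (phi (comm_val K w)).
Proof.
have [plin pl] := phi_hom; have [_ pD _ _] := linear_facts plin.
elim: w => [k|u [hu du eu] v [hv dv ev]] /=.
  case e : (Cantor.of_nat k) => [i j].
  exists (lie_var K (Cantor.to_nat (i.+1, j))).
    by apply: lspan_gen; exists (CX (Cantor.to_nat (i.+1, j))).
  by rewrite !phi_var /elim_var Cantor.cancel_of_to e.
exists (lie hu (comm_val K v) + lie (comm_val K u) hv).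
  rewrite size_cat; apply: lspanD; apply: lie_degree_le_lie => //.
    by apply: lspan_gen; exists v => /=.
  by apply: lspan_gen; exists u => /=.
rewrite pD !pl eu ev; set U := phi _; set V' := phi _.
have := lie_jacobi xa U V'.
rewrite (lieC V' (lie _ _)) (lieC V' xa) lieNr.
by rewrite -addrA -opprD => /eqP; rewrite subr_eq0 => /eqP ->; rewrite addrC.
Qed.

(** Each occurrence of X_a lowers the degree by one: it is absorbed in the index i
    of a letter y_(i,j). *)
Lemma elim_comm c : c = CX a \/
  exists2 h, lie_degree_le (size (letters c) - count_mem a (letters c)) h &
    phi h = comm_val K c.
Proof.
have [plin pl] := phi_hom; have [p0 _ pN _] := linear_facts plin.
have shift d h : lie_degree_le d h -> exists2 h', lie_degree_le d h' & phi h' = lie xa (phi h).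
  move: h; apply: lspan_ind => [|e _ v [w /= wd <-] _ [h' hd he]].
    by exists 0; [exact: lspan0|rewrite p0 lie0r].
  have [h2 h2d h2e] := elim_shift w.
  exists (e *: h2 + h'); first by apply: lspanP => //; exact: lie_degree_le_mono h2d.
  by rewrite !plin liePr h2e he.
elim: c => [i|u IHu v IHv].
  have [->|ia] := eqVneq i a; [by left|right].
  exists (lie_var K (Cantor.to_nat (0, unbump a i)%N)).
    by rewrite /= (negPf ia); apply: lspan_gen; exists (CX (Cantor.to_nat (0, unbump a i)%N)).
  by rewrite phi_var /elim_var Cantor.cancel_of_to /= unbumpK // inE.
right; rewrite /= size_cat count_cat.
case: IHu => [->|[hu du eu]]; case: IHv => [->|[hv dv ev]].
- by exists 0; [exact: lspan0|rewrite p0 /= liexx].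
- have [h hd he] := shift _ _ dv; exists h; last by rewrite he ev.
  by rewrite /= eqxx subnDl.
- have [h hd he] := shift _ _ du; exists (- h).
    by rewrite /= eqxx subnDr -scaleN1r; exact: lspanZ.
  by rewrite pN he eu /= [RHS]lieC.
- exists (lie hu hv); last by rewrite pl eu ev.
  have subnACA (x y p q : nat) : (p <= x -> q <= y ->
    x + y - (p + q) = (x - p) + (y - q))%N by lia.
  rewrite subnACA ?count_size //.
  exact: lie_degree_le_lie.
Qed.

Section Coinduced.
Variables (V : lmodType K) (Z : nat -> V -> V).
Hypothesis Zlin : forall i, linear (Z i).

(** The module coinduced from the ideal: given operators [Z] for the y_(i,j) on V,
    the sequence F stands for the functional D^n |-> F n, where D = ad X_a acts by
    shift, and X_j acts through D^n X_j = sum_k C(n,k) (ad D)^k(X_j) D^(n-k).  No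
    division occurs, so this works in every characteristic. *)
Definition coind_op (i : nat) (F : nat -> V) : nat -> V :=
  if i == a then fun n => F n.+1 else
  fun n => \sum_(k < n.+1) Z (Cantor.to_nat (val k, unbump a i)) (F (n - k)%N) *+ 'C(n, k).

Lemma coind_op_lin i : linear (coind_op i).
Proof.
move=> c F G; rewrite /coind_op; case: eqP => _; apply/funext => n //.
rewrite !fctE scaler_sumr -big_split; apply: eq_bigr => k _.
by rewrite Zlin mulrnDl scalerMnr.
Qed.

(** By induction on i from the commutator with the shift and Pascal's rule. *)
Lemma coind_elim_var i j F n :
  lie_op coind_op (iter i (lie xa) (lie_var K (bump a j))) F n =
  \sum_(k < n.+1) Z (Cantor.to_nat ((i + k)%N, j)) (F (n - k)%N) *+ 'C(n, k).
Proof.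
elim: i F n => [|i IH] F n.
  rewrite /= lie_op_var; last exact: coind_op_lin.
  rewrite /coind_op eq_sym (negPf (neq_bump _ _)) bumpK.
  by apply: eq_bigr => k _; rewrite add0n.
(* Both sides of the recursion for (ad D) y_(i,j) share the terms with C(n, k+1). *)
have DE G p : lie_op coind_op xa G p = G p.+1.
  by rewrite lie_op_var /coind_op ?eqxx //; exact: coind_op_lin.
rewrite iterS lie_op_lie; last exact: coind_op_lin.
rewrite !fctE DE !IH.
pose A := Z (Cantor.to_nat (i, j)) (F n.+1).
pose B (k : nat) := Z (Cantor.to_nat ((i.+1 + k)%N, j)) (F (n - k)%N).
have -> : \sum_(k < n.+2) Z (Cantor.to_nat ((i + k)%N, j)) (F (n.+1 - k)%N) *+ 'C(n.+1, k) =
    A + \sum_(k < n.+1) B k *+ 'C(n, k.+1) + \sum_(k < n.+1) B k *+ 'C(n, k).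
  rewrite big_ord_recl subn0 bin0 addn0 -addrA -big_split; congr (_ + _).
  by apply: eq_bigr => k _; rewrite subSS binS mulrnDr addnS.
have -> : \sum_(k < n.+1) Z (Cantor.to_nat ((i + k)%N, j)) (lie_op coind_op xa F (n - k)%N) *+ 'C(n, k) =
    A + \sum_(k < n.+1) B k *+ 'C(n, k.+1).
  rewrite big_ord_recl subn0 bin0 addn0 DE [in RHS]big_ord_recr /= bin_small //.
  rewrite mulr0n addr0; congr (_ + _).
  by apply: eq_bigr => k _; rewrite DE subnSK // addnS.
by rewrite addrC addKr.
Qed.

(** Evaluation at 0 intertwines the ideal's action on sequences with [Z]; every
    representation of the free Lie algebra on the y_(i,j) is thus visible in one of L(X). *)
Lemma coind_elim h F : lie_op coind_op (phi h) F 0%N = lie_op Z h (F 0%N).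
Proof.
have [plin pl] := phi_hom; have [p0 pD pN pZ] := linear_facts plin.
have cL G := linear_facts (lie_opP coind_op_lin G).
elim/lcls_ind: h => t; rewrite lie_opE //.
elim: t F => /= [k||t IH|s IHs t IHt|b t IH|s IHs t IHt] F;
  have [c0 cD cN cZ] := cL F.
- rewrite phi_var /elim_var; case e : (Cantor.of_nat k) => [i j].
  by rewrite coind_elim_var big_ord1 subn0 bin0 addn0 mulr1n -e Cantor.cancel_to_of.
- by rewrite lcls0 p0 c0.
- by rewrite lclsN pN -IH cN.
- by rewrite lclsD pD -IHs -IHt cD.
- by rewrite lclsZ pZ -IH cZ.
- rewrite lcls_lie pl lie_op_lie; last exact: coind_op_lin.
  by rewrite -IHt -IHs -IHs -IHt.
Qed.
End Coinduced.
End Elimination.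

Section Faithful.
Variable K : fieldType.
Local Notation L := (free_lie K).

(** The kernel of the map from the free Lie algebra to the free associative
    algebra, in the form: killed by every choice of operators. *)
Definition lie_null (g : L) : Prop :=
  forall (V : lmodType K) (X : nat -> V -> V), (forall i, linear (X i)) ->
  forall v, lie_op X g v = 0.

Lemma lie_nullP a g h : lie_null g -> lie_null h -> lie_null (a *: g + h).
Proof.
by move=> gn hn V X Xlin v; rewrite lie_opP // gn // hn // scaler0 addr0.
Qed.

Definition comm_span (d : nat) (s : seq nat) : set L :=
  lspan [set comm_val K w | w in
    [set w | (size (letters w) <= d)%N /\ {subset letters w <= s}]].

Lemma lie_degree_le_comm_span d (g : L) :
  lie_degree_le d g -> exists s, comm_span d s g.
Proof.
move: g; apply: lspan_ind => [|a _ v [w /= wd <-] _ [s sv]].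
  by exists [::]; exact: lspan0.
exists (letters w ++ s); apply: lspanP.
  by apply: lspan_gen; exists w => //; split=> // i iw; rewrite mem_cat iw.
apply: lspan_mono sv => _ [u [ud us] <-]; exists u => //; split=> // i /us.
by rewrite mem_cat orbC => ->.
Qed.

Lemma comm_span_split d a s (g : L) : comm_span d (a :: s) g ->
  exists g1 g2, [/\ g = g1 + g2, comm_span d s g2 &
    lspan [set comm_val K w | w in
      [set w | (size (letters w) <= d)%N /\ a \in letters w]] g1].
Proof.
move: g; apply: lspan_ind => [|c _ v [w [wd ws] <-] _ [g1 [g2 [-> g2s g1s]]]].
  by exists 0, 0; split; [rewrite addr0|exact: lspan0|exact: lspan0].
have [aw|aw] := boolP (a \in letters w).
  exists (c *: comm_val K w + g1), g2; split=> //; first by rewrite addrA.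
  by apply: lspanP => //; apply: lspan_gen; exists w.
exists g1, (c *: comm_val K w + g2); split=> //; first by rewrite addrCA.
apply: lspanP => //; apply: lspan_gen; exists w => //; split=> // i iw.
have := ws i iw; rewrite inE => /orP[/eqP ia|//].
by rewrite -ia iw in aw.
Qed.

(** Replacing the operator of X_a by 0 kills [g1] and does not change the action of
    [g2]. *)
Lemma lie_null_split d a s (g1 g2 : L) : a \notin s ->
  comm_span d s g2 ->
  lspan [set comm_val K w | w in
      [set w | (size (letters w) <= d)%N /\ a \in letters w]] g1 ->
  lie_null (g1 + g2) -> lie_null g2.
Proof.
move=> as_ g2s g1s n12 V X Xlin v.
pose X' i := if i == a then fun=> 0 else X i.
have X'lin i : linear (X' i).
  by rewrite /X'; case: eqP => // _ c x y; rewrite scaler0 addr0.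
have [z0 zD _ _] := linear_facts (lie_opP X'lin v).
have w2 w u : a \notin letters w -> lie_op X' (comm_val K w) u = lie_op X (comm_val K w) u.
  elim: w u => [i|w1 IH1 w2 IH2] u /=.
    by rewrite !lie_op_var // /X' inE eq_sym => /negPf ->.
  by rewrite mem_cat negb_or => /andP[a1 a2]; rewrite !lie_op_lie // !IH1 // !IH2 // IH1.
have w1 w u : a \in letters w -> lie_op X' (comm_val K w) u = 0.
  have w0 w' : lie_op X' (comm_val K w') 0 = 0.
    by have [h _ _ _] := linear_facts (lie_op_lin X'lin (comm_val K w')).
  elim: w u => [i|u1 IH1 u2 IH2] u /=.
    by rewrite !lie_op_var // /X' inE eq_sym => ->.
  rewrite mem_cat !lie_op_lie // => /orP[a1|a2].
    by rewrite !IH1 // w0 subr0.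
  by rewrite !IH2 // w0 subr0.
have e1 : lie_op X' g1 v = 0.
  move: g1 g1s {n12}; apply: lspan_ind => [//|c _ g [w [_ aw] <-] _ IH].
  by rewrite lie_opP // IH w1 // scaler0 addr0.
have e2 : lie_op X' g2 v = lie_op X g2 v.
  have [t0 _ _ _] := linear_facts (lie_opP Xlin v).
  move: g2 g2s {n12}; apply: lspan_ind => [|c _ g [w [_ aw] <-] _ IH]; first by rewrite z0 t0.
  rewrite !lie_opP // IH w2 //; apply: contra as_; exact: aw.
by rewrite -e2 -[LHS]add0r -e1 -zD n12.
Qed.

(** The free Lie algebra embeds in the free associative algebra, over any field.
    By the previous splitting one may assume that X_a occurs in every commutator
    of g; then g = c X_a + phi h with h of smaller degree, and the coinduced
    modules give c = 0 and show that h is again in the kernel. *)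
Theorem lie_null_eq0 d (g : L) : lie_degree_le d g -> lie_null g -> g = 0.
Proof.
elim: d g => [|d IHd] g.
  move=> gd _.
  move: g gd; apply: lspan_ind => // c g v [w /= w0 _].
  by move: w0; rewrite leqNgt size_letters_gt0.
move=> /lie_degree_le_comm_span[s]; elim: s g => [|a s IHs] g.
  move=> gs _.
  move: g gs; apply: lspan_ind => // c g v [w [_ w0] _].
  have [i iw] : exists i, i \in letters w.
    elim: w {w0} => [i|u [i iu] v' _]; first by exists i; rewrite mem_head.
    by exists i; rewrite /= mem_cat iu.
  by have := w0 i iw.
move=> /[dup] gas /comm_span_split[g1 [g2 [gE g2s g1s]]].
have [as_|as_] := boolP (a \in s).
  apply: IHs; apply: lspan_mono gas => _ [w [wd ws] <-]; exists w => //.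
  by split=> // i /ws; rewrite inE => /orP[/eqP ->|].
move=> gn; have n2 : lie_null g2 by apply: (lie_null_split as_ g2s g1s); rewrite -gE.
have n1 : lie_null g1.
  rewrite (_ : g1 = -1 *: g2 + g); first exact: lie_nullP.
  by rewrite gE scaleN1r addrC addrK.
rewrite gE (IHs g2) // addr0.
have [phi [[phi_hom phi_var] _]] := free_lie_universal (elim_var K a).
have [plin _] := phi_hom; have [p0 _ _ _] := linear_facts plin.
have [c [h [hd {}gE]]] : exists c h, lie_degree_le d h /\ g1 = c *: lie_var K a + phi h.
  move: g1 g1s {gE n1}; apply: lspan_ind => [|c _ v [w [wd aw] <-] _ [c' [h [hd ->]]]].
    by exists 0, 0; rewrite p0 scale0r addr0; split=> //; exact: lspan0.
  have [->|[h' h'd h'e]] := elim_comm phi_hom phi_var w.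
    by exists (c + c'), h; split=> //; rewrite scalerDl addrA.
  exists c', (c *: h' + h); split; last by rewrite plin h'e addrCA.
  apply: lspanP => //; apply: lie_degree_le_mono h'd.
  rewrite leq_subLR (leq_trans wd) // -add1n leq_add2r.
  by rewrite -has_count has_pred1.
have E (V : lmodType K) (Z : nat -> V -> V) (F : nat -> V) :
    (forall i, linear (Z i)) -> c *: F 1%N + lie_op Z h (F 0%N) = 0.
  move=> Zlin; have lin := coind_op_lin a Zlin.
  rewrite -(coind_elim phi_hom phi_var Zlin).
  have := n1 _ _ lin F; rewrite gE lie_opP // lie_op_var // => /(congr1 (@^~ 0%N)).
  by rewrite /coind_op eqxx.
(* On scalars, with all Z equal to the identity, the sequence 0, 1, 0, ... is
   mapped by X_a to a sequence with value 1 at 0. *)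
have c0 : c = 0.
  have := @E K^o (fun=> id) (fun n => (n == 1)%:R) (fun=> fun _ _ _ => erefl).
  have [-> _ _ _] := linear_facts (@lie_op_lin _ K^o (fun=> id) (fun=> fun _ _ _ => erefl) h).
  by rewrite /= addr0 [_ *: _]mulr1.
have h0 : h = 0.
  apply: IHd => // V Z Zlin v.
  by have := E V Z (fun=> v) Zlin; rewrite c0 scale0r add0r.
by rewrite gE h0 p0 c0 scale0r addr0.
Qed.

End Faithful.

(** * Linearization of a Lie identity *)

HB.instance Definition _ := gen_eqMixin commutator.
HB.instance Definition _ := gen_choiceMixin commutator.

Section Words.
Variable K : fieldType.

(** Vanishing of all collected coefficients is how formal linear combinations
    kept as lists are compared below. *)
Lemma lincomb_eq0 (T : eqType) (V : lmodType K) (G : T -> V) (l : seq (K * T)) :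
  (forall w, \sum_(p <- l | p.2 == w) p.1 = 0) -> \sum_(p <- l) p.1 *: G p.2 = 0.
Proof.
move=> l0; pose ws := undup [seq p.2 | p <- l].
transitivity (\sum_(w <- ws) (\sum_(p <- l | p.2 == w) p.1) *: G w); last first.
  by rewrite big1 // => w _; rewrite l0 scale0r.
under [RHS]eq_bigr do rewrite scaler_suml big_mkcond.
rewrite exchange_big /=; apply: eq_big_seq => p pl.
rewrite (bigD1_seq p.2) ?undup_uniq ?mem_undup ?map_f //= eqxx big1 ?addr0 //.
by move=> w /negPf; rewrite eq_sym => ->.
Qed.

(** The terms of a commutator in the free associative algebra. *)
Fixpoint expand (c : commutator) : seq (K * seq nat) :=
  match c with
  | CX i => [:: (1, [:: i])]
  | CBr u v =>
      [seq (p.1 * q.1, p.2 ++ q.2) | p <- expand u, q <- expand v] ++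
      [seq (- (p.1 * q.1), q.2 ++ p.2) | p <- expand u, q <- expand v]
  end.

Lemma expand_perm c p : p \in expand c -> perm_eq p.2 (letters c).
Proof.
elim: c p => [i|u IHu v IHv] p /=; first by rewrite inE => /eqP ->.
rewrite mem_cat => /orP[] /allpairsP[[q r] /= [/IHu qu /IHv rv ->]] /=.
  exact: perm_cat.
by rewrite perm_catC; exact: perm_cat.
Qed.

Lemma lie_op_expand (V : lmodType K) (X : nat -> V -> V) (Xlin : forall i, linear (X i)) c v :
  lie_op X (comm_val K c) v = \sum_(p <- expand c) p.1 *: foldr X v p.2.
Proof.
elim: c v => [i|u IHu w IHw] v /=; first by rewrite lie_op_var // big_seq1 scale1r.
have lin g := lie_op_lin Xlin g.
have opS g (r : seq (K * seq nat)) : lie_op X g (\sum_(p <- r) p.1 *: foldr X v p.2) =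
    \sum_(p <- r) p.1 *: lie_op X g (foldr X v p.2).
  have [g0 gD _ gZ] := linear_facts (lin g).
  elim: r => [|p r IH]; first by rewrite !big_nil g0.
  by rewrite !big_cons gD gZ IH.
rewrite lie_op_lie // (IHw v) (IHu v) !opS big_cat !big_allpairs_dep /=; congr (_ + _).
  rewrite exchange_big /=; apply: eq_bigr => p _.
  rewrite IHu scaler_sumr; apply: eq_bigr => q _.
  by rewrite foldr_cat scalerA mulrC.
rewrite -sumrN; apply: eq_bigr => p _.
rewrite IHw scaler_sumr -sumrN; apply: eq_bigr => q _.
by rewrite foldr_cat scalerA scaleNr.
Qed.

(** The part of f of degree exactly [m.+1] is nonzero since f has no smaller degree,
    so by faithfulness some associative word occurs in it; words of that length come
    from no other part. *)
Lemma top_word m (f : free_lie K) : has_lie_degree f m.+1 ->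
  exists fs : seq (K * commutator),
    [/\ forall p, p \in fs -> (size (letters p.2) <= m.+1)%N,
        f = \sum_(p <- fs) p.1 *: comm_val K p.2 &
        exists2 w, size w = m.+1 &
          \sum_(p <- fs) p.1 * (\sum_(q <- expand p.2 | q.2 == w) q.1) != 0].
Proof.
move=> [fd fmin].
have [fs [fss fE]] : exists fs : seq (K * commutator),
    (forall p, p \in fs -> (size (letters p.2) <= m.+1)%N) /\
    f = \sum_(p <- fs) p.1 *: comm_val K p.2.
  move: f fd {fmin}; apply: lspan_ind => [|a _ v [w /= wd <-] _ [fs [fss ->]]].
    by exists [::]; rewrite big_nil.
  exists ((a, w) :: fs); rewrite big_cons; split=> // p.
  by rewrite inE => /orP[/eqP ->|/fss].
exists fs; split=> //.
pose top := [seq p <- fs | size (letters p.2) == m.+1].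
have topE w : size w = m.+1 ->
    \sum_(p <- fs) p.1 * (\sum_(q <- expand p.2 | q.2 == w) q.1) =
    \sum_(p <- top) p.1 * (\sum_(q <- expand p.2 | q.2 == w) q.1).
  move=> wm; rewrite big_filter [RHS]big_mkcond; apply: eq_bigr => p _.
  case: ifPn => // ps; rewrite big_seq_cond big1 ?mulr0 // => q /andP[qp /eqP qw].
  by move: ps; rewrite -(perm_size (expand_perm qp)) qw wm eqxx.
apply: contrapT => H.
(* If the top part vanished, f would have degree at most m. *)
suff top0 : \sum_(p <- top) p.1 *: comm_val K p.2 = 0.
  suff /fmin : lie_degree_le m f by rewrite ltnn.
  rewrite fE (bigID (fun p => size (letters p.2) == m.+1)) -big_filter top0 /= add0r.
  rewrite -big_filter; apply: lspan_sum => p; rewrite mem_filter => /andP[pm pf].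
  apply: lspanZ; apply: lspan_gen; exists p.2 => //=.
  by rewrite -ltnS ltn_neqAle pm; exact: fss.
apply: (@lie_null_eq0 _ m.+1).
  apply: lspan_sum => p; rewrite mem_filter => /andP[_ pf].
  by apply: lspanZ; apply: lspan_gen; exists p.2 => //=; exact: fss.
move=> V X Xlin v.
have -> : lie_op X (\sum_(p <- top) p.1 *: comm_val K p.2) v =
    \sum_(p <- [seq (p.1 * q.1, q.2) | p <- top, q <- expand p.2]) p.1 *: foldr X v p.2.
  have [x0 xD _ xZ] := linear_facts (lie_opP Xlin v).
  rewrite big_allpairs_dep /=; elim: top {topE} => [|p r IH]; first by rewrite !big_nil x0.
  rewrite !big_cons xD xZ IH lie_op_expand // scaler_sumr; congr (_ + _).
  by apply: eq_bigr => q _; rewrite scalerA.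
apply: lincomb_eq0 => w.
rewrite big_mkcond big_allpairs_dep /=; under eq_bigr do rewrite -big_mkcond.
transitivity (\sum_(p <- top) p.1 * (\sum_(q <- expand p.2 | q.2 == w) q.1)).
  by apply: eq_bigr => p _; rewrite mulr_sumr.
have [wm|wm] := eqVneq (size w) m.+1.
  by rewrite -topE //; apply/eqP/negPn/negP => h; apply: H; exists w.
rewrite big_seq big1 // => p; rewrite mem_filter => /andP[/eqP pm _].
rewrite big_seq_cond big1 ?mulr0 // => q /andP[/expand_perm/perm_size qp /eqP qw].
by move: wm; rewrite -qw qp pm eqxx.
Qed.

End Words.
Arguments expand : clear implicits.

Section Linearization.
Variables (K : fieldType).

Fixpoint ceval (A : lieAlgType K) (x : nat -> A) (c : commutator) : A :=
  match c with CX i => x i | CBr u v => lie (ceval x u) (ceval x v) end.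

Definition act (A : lieAlgType K) (x : nat -> A) (t : A) (w : seq nat) : A :=
  foldl (fun t i => lie t (x i)) t w.

Lemma act_lin (A : lieAlgType K) (x : nat -> A) w : linear (fun t => act x t w).
Proof.
elim/last_ind: w => // w i IH c u v.
by rewrite /act -cats1 !foldl_cat /= -!/(act _ _ _) IH liePl.
Qed.

Lemma act_cat (A : lieAlgType K) (x : nat -> A) t u v :
  act x t (u ++ v) = act x (act x t u) v.
Proof. by rewrite /act foldl_cat. Qed.

Lemma act_sum (A : lieAlgType K) (x : nat -> A) w (I : Type) (r : seq I) (P : pred I)
    (c : I -> K) (F : I -> A) :
  act x (\sum_(i <- r | P i) c i *: F i) w = \sum_(i <- r | P i) c i *: act x (F i) w.
Proof.
have [f0 fD _ fZ] := linear_facts (act_lin x w).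
elim: r => [|i r IH]; first by rewrite !big_nil f0.
by rewrite !big_cons; case: (P i); rewrite ?fD ?fZ IH.
Qed.

(** The adjoint action turns commutators into commutators of operators, so it
    factors through the associative expansion. *)
Lemma lie_ceval (A : lieAlgType K) (x : nat -> A) c t :
  lie t (ceval x c) = \sum_(p <- expand K c) p.1 *: act x t p.2.
Proof.
elim: c t => [i|u IHu v IHv] t /=; first by rewrite big_seq1 scale1r.
rewrite big_cat !big_allpairs_dep /=.
set U := ceval x u; set V := ceval x v.
rewrite lie_lie; congr (_ + _).
  rewrite IHv IHu exchange_big; apply: eq_bigr => q _ /=.
  rewrite act_sum scaler_sumr; apply: eq_bigr => p _.
  by rewrite scalerA act_cat mulrC.
rewrite IHu IHv -sumrN; apply: eq_bigr => p _ /=.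
rewrite act_sum scaler_sumr -sumrN; apply: eq_bigr => q _.
by rewrite scalerA act_cat scaleNr.
Qed.

Lemma expand_nil c p : p \in expand K c -> p.2 != [::].
Proof.
by move=> /expand_perm/perm_size; have := size_letters_gt0 c; case: p.2 => //= + e; rewrite -e.
Qed.

(** A commutator that involves the letter [a] once is determined by the words of
    its associative expansion that begin with [a]: rewrite it with [a] in front by
    anticommutativity, and expand the remaining factors by [lie_ceval]. *)
Lemma ceval_left_normed (A : lieAlgType K) (x : nat -> A) c a :
  count_mem a (letters c) = 1%N ->
  ceval x c = \sum_(p <- expand K c)
    ((head 0%N p.2 == a)%:R * p.1) *: act x (x a) (behead p.2).
Proof.
have headN w p : count_mem a (letters w) = 0%N -> p \in expand K w ->
    exists i s, p.2 = i :: s /\ (i == a) = false.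
  move=> aw pw; have := expand_nil pw; have := expand_perm pw => /permP/(_ (pred1 a)).
  by rewrite aw; case: p.2 => //= i s; case ia: (i == a) => // _ _; exists i, s.
have lie_sum (l : seq (K * seq nat)) V : lie (\sum_(p <- l)
    ((head 0%N p.2 == a)%:R * p.1) *: act x (x a) (behead p.2)) V =
    \sum_(p <- l) ((head 0%N p.2 == a)%:R * p.1) *: lie (act x (x a) (behead p.2)) V.
  elim: l => [|p l IH]; first by rewrite !big_nil lie0l.
  by rewrite !big_cons liePl IH.
elim: c => [i|u IHu v IHv] /=.
  by case: (eqVneq i a) => [->|//] _; rewrite big_seq1 /= eqxx mul1r scale1r.
rewrite count_cat => cuv.
have [[cu cv]|[cu cv]] : (count_mem a (letters u) = 1 /\ count_mem a (letters v) = 0 \/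
    count_mem a (letters u) = 0 /\ count_mem a (letters v) = 1)%N.
  by case: (count _ (letters u)) cuv => [|[|n]] //= h; [right|left]; split; lia.
- rewrite big_cat !big_allpairs_dep /= (IHu cu) lie_sum.
  rewrite [X in _ = _ + X]big_seq [X in _ = _ + X]big1 ?addr0; last first.
    move=> p _; rewrite big_seq big1 // => q /(headN _ _ cv)[i [s [-> ia]]].
    by rewrite /= ia mul0r scale0r.
  rewrite big_seq [RHS]big_seq; apply: eq_bigr => p pu.
  have := expand_nil pu; case ep : p.2 => [//|i s] _ /=.
  rewrite lie_ceval scaler_sumr; apply: eq_bigr => q _.
  by rewrite scalerA act_cat mulrA.
- rewrite big_cat !big_allpairs_dep /= lieC (IHv cv) lie_sum.
  rewrite [X in _ = X + _]big_seq [X in _ = X + _]big1 ?add0r; last first.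
    move=> p /(headN _ _ cu)[i [s [-> ia]]]; rewrite big1 // => q _.
    by rewrite /= ia mul0r scale0r.
  rewrite exchange_big -sumrN big_seq [RHS]big_seq; apply: eq_bigr => q qv.
  have := expand_nil qv; case eq : q.2 => [//|i s] _ /=.
  rewrite lie_ceval scaler_sumr -sumrN; apply: eq_bigr => p _.
  by rewrite scalerA act_cat mulrN scaleNr -mulrA [q.1 * _]mulrC.
Qed.

(** The substitution of the sum of the e_j y_j over the j < m with W j = i for X_i: expanding
    it relabels each letter i of a commutator by some j above it. *)
Section Lifts.
Variables (m : nat) (W : nat -> nat).

Fixpoint lifts (c : commutator) : seq commutator :=
  match c with
  | CX i => [seq CX j | j <- iota 0 m & W j == i]
  | CBr u v => [seq CBr u' v' | u' <- lifts u, v' <- lifts v]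
  end.

Fixpoint word_lifts (w : seq nat) : seq (seq nat) :=
  if w is i :: w' then [seq j :: u | j <- [seq j <- iota 0 m | W j == i], u <- word_lifts w']
  else [:: [::]].

Lemma ceval_lifts (A : lieAlgType K) (e : nat -> K) (y : nat -> A) c :
  ceval (fun i => \sum_(j <- iota 0 m | W j == i) e j *: y j) c =
  \sum_(c' <- lifts c) (\prod_(j <- letters c') e j) *: ceval y c'.
Proof.
elim: c => [i|u IHu v IHv] /=.
  by rewrite big_map big_filter; apply: eq_bigr => j _; rewrite /= big_seq1.
rewrite IHu IHv big_allpairs_dep.
elim: (lifts u) => [|u' lu IH]; first by rewrite !big_nil lie0l.
rewrite !big_cons liePl IH; congr (_ + _).
elim: (lifts v) => [|v' lv IHlv]; first by rewrite !big_nil lie0r scaler0.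
rewrite !big_cons liePr scalerDr IHlv scalerA.
by rewrite /= big_cat.
Qed.

Lemma size_lifts c c' : c' \in lifts c -> size (letters c') = size (letters c).
Proof.
elim: c c' => [i|u IHu v IHv] c' /=; first by move=> /mapP[j _ ->].
by move=> /allpairsP[[a b] /= [/IHu ea /IHv eb ->]] /=; rewrite !size_cat ea eb.
Qed.

Lemma lifts_lt c c' j : c' \in lifts c -> j \in letters c' -> (j < m)%N.
Proof.
elim: c c' => [i|u IHu v IHv] c' /=.
  move=> /mapP[k]; rewrite mem_filter mem_iota => /andP[_ /andP[_ km]] ->.
  by rewrite inE => /eqP ->.
by move=> /allpairsP[[a b] /= [/IHu ea /IHv eb ->]] /=; rewrite mem_cat => /orP[].
Qed.

Lemma word_lifts_cat (F : seq nat -> K) u v :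
  \sum_(w <- word_lifts (u ++ v)) F w =
  \sum_(a <- word_lifts u) \sum_(b <- word_lifts v) F (a ++ b).
Proof.
elim: u F => [|i u IH] F /=; first by rewrite big_seq1.
rewrite !big_allpairs_dep; apply: eq_bigr => j _.
by rewrite (IH (fun w => F (j :: w))).
Qed.

(** Relabelling commutes with associative expansion; [F] is a test function on
    words. *)
Lemma expand_lifts (F : seq nat -> K) c :
  \sum_(c' <- lifts c) \sum_(p <- expand K c') p.1 * F p.2 =
  \sum_(p <- expand K c) p.1 * \sum_(w <- word_lifts p.2) F w.
Proof.
elim: c F => [i|u IHu v IHv] F /=.
  rewrite big_map big_seq1 mul1r /= big_flatten big_map; apply: eq_bigr => j _.
  by rewrite !big_seq1 mul1r.
rewrite big_allpairs_dep big_cat !big_allpairs_dep /=.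
transitivity (\sum_(u' <- lifts u) \sum_(p <- expand K u') p.1 *
  (\sum_(v' <- lifts v) \sum_(q <- expand K v') q.1 * (F (p.2 ++ q.2) - F (q.2 ++ p.2)))).
  apply: eq_bigr => u' _; under [RHS]eq_bigr do rewrite mulr_sumr.
  rewrite [RHS]exchange_big; apply: eq_bigr => v' _.
  rewrite big_cat !big_allpairs_dep /= -big_split; apply: eq_bigr => p _ /=.
  rewrite mulr_sumr -big_split; apply: eq_bigr => q _ /=; ring.
have Ev z : \sum_(v' <- lifts v) \sum_(q <- expand K v') q.1 * (F (z ++ q.2) - F (q.2 ++ z)) =
    \sum_(q <- expand K v) q.1 * \sum_(w <- word_lifts q.2) (F (z ++ w) - F (w ++ z)).
  exact: (IHv (fun w => F (z ++ w) - F (w ++ z))).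
pose G z := \sum_(q <- expand K v) q.1 * \sum_(w <- word_lifts q.2) (F (z ++ w) - F (w ++ z)).
transitivity (\sum_(u' <- lifts u) \sum_(p <- expand K u') p.1 * G p.2).
  by apply: eq_bigr => u' _; apply: eq_bigr => p _; congr (_ * _); exact: Ev.
rewrite IHu.
rewrite -big_split; apply: eq_bigr => p _ /=.
rewrite /G exchange_big mulr_sumr -big_split; apply: eq_bigr => q _ /=.
rewrite !word_lifts_cat -mulr_sumr [X in _ = _ + _ * X]exchange_big /=.
under eq_bigr do rewrite big_split /= sumrN.
by rewrite big_split /= sumrN; ring.
Qed.

Lemma count_word_lifts v u : all (fun j => j < m)%N u ->
  \sum_(w <- word_lifts v) (w == u)%:R = (v == map W u)%:R :> K.
Proof.
elim: v u => [|i v IH] [|j u] /=.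
- by rewrite big_seq1 eqxx.
- by rewrite big_seq1.
- by rewrite big_allpairs_dep /= big1 // => k _; rewrite big1.
move=> /andP[jm um]; rewrite big_allpairs_dep /= big_filter.
under eq_bigr => k _ do under eq_bigr => w _ do rewrite eqseq_cons -mulnb natrM.
under eq_bigr => k _ do rewrite -mulr_sumr IH //.
rewrite big_mkcond (bigD1_seq j) ?iota_uniq ?mem_iota //= eqxx mul1r big1 ?addr0.
  by rewrite eqseq_cons eq_sym; case: (i == W j).
by move=> k /negPf ->; rewrite mul0r if_same.
Qed.

End Lifts.

(** The alternating sum over the subsets S of the substitutions y_j := 0, for j outside
    S, selects the terms that involve every y_j: it factors over j. *)
Lemma subset_alternating_sum m (s : seq nat) : all (fun j => j < m)%N s ->
  \sum_(S : {set 'I_m}) (\prod_(j < m) (if j \in S then 1 else -1)) *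
     \prod_(j <- s) (j \in [seq val i | i in S])%:R
  = (all (mem s) (iota 0 m))%:R :> K.
Proof.
move=> sm.
transitivity (\prod_(j < m) (1 - (val j \notin s)%:R) : K); last first.
  have [/allP h|/allPn[j]] := boolP (all (mem s) (iota 0 m)).
    rewrite big1 // => j _; have /h /= -> : val j \in iota 0 m by rewrite mem_iota add0n ltn_ord.
    by rewrite subr0.
  rewrite mem_iota add0n => /andP[_ jm] js.
  by rewrite (bigD1 (Ordinal jm)) //= js subrr mul0r.
rewrite bigA_distr; apply: eq_bigr => S _.
have [/allP h|/allPn[j js /= jS]] := boolP (all (mem [seq val i | i in S]) s).
  rewrite [X in _ * X]big_seq [X in _ * X]big1 => [|j /h /= -> //].
  rewrite mulr1; apply: eq_bigr => j _; case: ifPn => // jS.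
  suff -> : val j \notin s by [].
  by apply: contra jS => /h /mapP[k]; rewrite mem_enum => kS /val_inj ->.
have jm := allP sm _ js.
rewrite [X in _ * X](big_rem j) //= (negPf jS) mul0r mulr0.
rewrite (bigD1 (Ordinal jm)) //= js oppr0 ifF ?mul0r //.
by apply: contraNF jS => jS; apply/mapP; exists (Ordinal jm); rewrite ?mem_enum.
Qed.

(** The consequence obtained from f by the substitution along the word w is
    multilinear because f has degree at most the length of w, and its coefficient at
    y_0 y_1 ... y_m is that of w in f.  The list [l] depends on f only. *)
Theorem left_normed_identity m (fs : seq (K * commutator)) w : size w = m.+1 ->
  (forall p, p \in fs -> (size (letters p.2) <= m.+1)%N) ->
  \sum_(p <- fs) p.1 * (\sum_(q <- expand K p.2 | q.2 == w) q.1) != 0 ->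
  exists l : seq (K * seq nat),
    (forall p, p \in l -> perm_eq p.2 (iota 0 m) /\ p.2 != iota 0 m) /\
    forall A : lieAlgType K,
      (forall x : nat -> A, \sum_(p <- fs) p.1 *: ceval x p.2 = 0) ->
      forall t (y : nat -> A), act y t (iota 0 m) = \sum_(p <- l) p.1 *: act y t p.2.
Proof.
move=> wm fss; set gamma := \sum_(p <- fs) _ => g0.
pose W := nth 0%N w.
pose full c := all (mem (letters c)) (iota 0 m.+1).
(* Relabelled commutators that use all labels, expanded with label 0 in front; the
   labels 1, ..., m are then renumbered from 0. *)
pose l0 := [seq (p.1 * q.1, [seq i.-1 | i <- behead q.2]) |
  p <- [seq (p.1, c) | p <- fs, c <- [seq c <- lifts m.+1 W p.2 | full c]],
  q <- [seq q <- expand K p.2 | head 0%N q.2 == 0%N]].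
have full_perm p c : p \in fs -> c \in lifts m.+1 W p.2 -> full c ->
    perm_eq (letters c) (iota 0 m.+1).
  move=> pf cl /allP fc; rewrite perm_sym.
  have /(uniq_min_size (iota_uniq 0 m.+1)) H : {subset iota 0 m.+1 <= letters c} by move=> i /fc.
  have [] := H; first by rewrite (size_lifts cl) size_iota fss.
  move=> sz eqi; apply: uniq_perm => //; first exact: iota_uniq.
  by rewrite -(eq_uniq _ eqi) ?iota_uniq.
have l0P p : p \in l0 -> perm_eq p.2 (iota 0 m).
  move=> /allpairsPdep[[c1 c] [q [/allpairsPdep[p' [c' [pf]]]]]].
  rewrite mem_filter => /andP[fc cl] [_ ->]; rewrite mem_filter => /andP[/eqP hq qe] -> /=.
  have := perm_trans (expand_perm qe) (full_perm _ _ pf cl fc).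
  have := expand_nil qe; case: q.2 hq => //= i s -> _; rewrite perm_cons => /(perm_map predn).
  by rewrite [X in perm_eq _ X](_ : _ = iota 0 m) // (iotaDl 1) -map_comp map_id.
have l0act (A : lieAlgType K) : (forall x : nat -> A, \sum_(p <- fs) p.1 *: ceval x p.2 = 0) ->
    forall t (y : nat -> A), \sum_(p <- l0) p.1 *: act y t p.2 = 0.
  (* The letter 0 is the base point t and j.+1 stands for y j. *)
  move=> fA t y; pose y' j := if j is j'.+1 then y j' else t.
  have actS s u : all (leq 1) s -> act y' u s = act y u (map predn s).
    elim: s u => //= j s IH u /andP[j1 s1].
    by rewrite -!/(act _ _ _) IH // /y'; case: j j1.
  pose e (S : {set 'I_m.+1}) j : K := (j \in [seq val i | i in S])%:R.
  pose wt (S : {set 'I_m.+1}) : K := \prod_(j < m.+1) (if j \in S then 1 else -1).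
  pose x S i := \sum_(j <- iota 0 m.+1 | W j == i) e S j *: y' j.
  transitivity (\sum_S wt S *: (\sum_(p <- fs) p.1 *: ceval (x S) p.2)); last first.
    by rewrite big1 // => S _; rewrite fA scaler0.
  under [RHS]eq_bigr do rewrite scaler_sumr.
  rewrite [RHS]exchange_big /l0 big_allpairs_dep big_allpairs_dep /=.
  rewrite big_seq [RHS]big_seq; apply: eq_bigr => p pf.
  transitivity (\sum_(c <- lifts m.+1 W p.2) (p.1 * (full c)%:R) *: ceval y' c); last first.
    under [RHS]eq_bigr do rewrite ceval_lifts scaler_sumr scaler_sumr.
    rewrite [RHS]exchange_big big_seq [RHS]big_seq; apply: eq_bigr => c cl /=.
    rewrite -[(full c)%:R]subset_alternating_sum; last by apply/allP => j /(lifts_lt cl).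
    rewrite mulr_sumr scaler_suml; apply: eq_bigr => S _.
    by rewrite !scalerA; congr (_ *: _); rewrite mulrA [p.1 * _]mulrC -mulrA.
  rewrite big_filter big_mkcond big_seq [RHS]big_seq; apply: eq_bigr => c cl.
  case: ifP => [fc|_]; last by rewrite mulr0 scale0r.
  have cp := full_perm _ _ pf cl fc.
  rewrite mulr1 (@ceval_left_normed _ _ _ 0%N); last by have /permP -> := cp; rewrite count_uniq_mem ?iota_uniq.
  rewrite scaler_sumr big_filter big_mkcond big_seq [RHS]big_seq; apply: eq_bigr => q qc.
  case: eqP => [hq|_]; last by rewrite mul0r scale0r scaler0.
  rewrite mul1r scalerA; congr (_ *: _).
  have := perm_trans (expand_perm qc) cp; have := expand_nil qc.
  case: q.2 hq => //= i s -> _; rewrite perm_cons => /perm_mem sP.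
  by rewrite actS //; apply/allP => j; rewrite sP mem_iota => /andP[].
have l0c : \sum_(p <- l0 | p.2 == iota 0 m) p.1 = gamma.
  rewrite big_mkcond /l0 big_allpairs_dep big_allpairs_dep /=.
  apply: eq_big_seq => p pf; rewrite big_filter.
  transitivity (p.1 * \sum_(c <- lifts m.+1 W p.2) \sum_(q <- expand K c) q.1 * (q.2 == iota 0 m.+1)%:R).
    rewrite mulr_sumr big_mkcond; apply: eq_big_seq => c cl.
    case: ifPn => [fc|nfc]; last first.
      rewrite big_seq big1 ?mulr0 // => q qc; case: eqP => [qi|_]; last by rewrite mulr0.
      case/negP: nfc; apply/allP => j; rewrite -qi /=.
      by rewrite (perm_mem (expand_perm qc)).
    have cp := full_perm _ _ pf cl fc.
    rewrite mulr_sumr big_filter big_mkcond; apply: eq_big_seq => q qc.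
    have := perm_trans (expand_perm qc) cp; have := expand_nil qc.
    case: q.2 => //= i s _; rewrite eqseq_cons; case: eqP => [->|_]; last by rewrite !mulr0.
    rewrite perm_cons => /perm_mem sP; rewrite -(inj_eq (inj_map succn_inj)).
    rewrite -map_comp (_ : map S (iota 0 m) = iota 1 m) ?(iotaDl 1) //.
    rewrite map_id_in => [|j]; last by rewrite /= sP mem_iota; case: j.
    by case: eqP => _; rewrite ?mulr1 ?mulr0.
  rewrite (expand_lifts _ _ (fun u => (u == iota 0 m.+1)%:R)); congr (_ * _).
  rewrite [RHS]big_mkcond; apply: eq_bigr => q _.
  rewrite count_word_lifts; last by apply/allP => j; rewrite mem_iota.
  have -> : map W (iota 0 m.+1) = w by rewrite -wm /W map_nth_iota0 ?take_size.
  by case: eqP => _; rewrite ?mulr1 ?mulr0.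
exists [seq (- gamma^-1 * p.1, p.2) | p <- l0 & p.2 != iota 0 m]; split.
  by move=> p /mapP[q]; rewrite mem_filter => /andP[qm /l0P qp] ->.
move=> A fA t y; have := l0act A fA t y.
rewrite (bigID (fun p => p.2 == iota 0 m)) /=.
rewrite (eq_bigr (fun p => p.1 *: act y t (iota 0 m))) => [|p /eqP -> //].
rewrite -scaler_suml l0c => /eqP; rewrite addr_eq0 => /eqP e.
rewrite big_map big_filter -[LHS]scale1r -(mulVf g0) -scalerA e -scaleN1r scalerA scaler_sumr.
by apply: eq_bigr => p _; rewrite scalerA mulrN1.
Qed.

End Linearization.

(** * Straightening left-normed products *)

Arguments act : simpl never.

Definition lexlt (w w' : seq nat) : Prop :=
  exists c i j r r', [/\ w = c ++ i :: r, w' = c ++ j :: r' & (i < j)%N].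

Lemma lexlt_cat p w w' r r' : lexlt w w' -> lexlt (p ++ w ++ r) (p ++ w' ++ r').
Proof.
move=> [c [i [j [s [s' [-> -> ij]]]]]].
by exists (p ++ c), i, j, (s ++ r), (s' ++ r'); rewrite -!catA.
Qed.

Lemma lexlt_head i j r r' : (i < j)%N -> lexlt (i :: r) (j :: r').
Proof. by exists [::], i, j, r, r'. Qed.

(** The rearrangements of a word are finitely many; reading them as numerals in a
    large base makes the lexicographic order the order of the values. *)
Lemma lex_ind (P : seq nat -> Prop) :
  (forall w, (forall w', perm_eq w' w -> lexlt w w' -> P w') -> P w) -> forall w, P w.
Proof.
move=> step w0; pose b := (sumn w0).+1; pose n := size w0.
pose val := foldl (fun acc i => acc * b + i)%N 0%N.
have foldE acc w : foldl (fun acc i => acc * b + i)%N acc w = (acc * b ^ size w + val w)%N.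
  elim: w acc => [|i w IH] acc; first by rewrite /= muln1 addn0.
  by rewrite /val /= IH [in RHS]IH mul0n add0n expnS mulnDl mulnA addnA.
have val_lt w : all (fun i => i < b)%N w -> (val w < b ^ size w)%N.
  elim: w => //= i w IH /andP[ib wb]; rewrite /val /= foldE mul0n add0n expnS.
  by rewrite (leq_trans (n := i.+1 * b ^ size w)) ?leq_mul2r ?ib ?orbT // mulSn addnC ltn_add2r IH.
have w0b : all (fun i => i < b)%N w0.
  apply/allP => i; rewrite /b ltnS; elim: (w0) => //= j w IH; rewrite inE.
  by case/orP => [/eqP ->|/IH h]; rewrite ?leq_addr // (leq_trans h) // leq_addl.
suff H k w : perm_eq w w0 -> (b ^ n - val w <= k)%N -> P w by exact: (H _ _ (perm_refl _) (leqnn _)).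
elim: k w => [|k IH] w ww0 wk.
  have wb : all (fun i => i < b)%N w by rewrite (perm_all _ ww0).
  have := val_lt _ wb; rewrite (perm_size ww0) -/n; lia.
apply: step => w' w'w lt; have w'w0 := perm_trans w'w ww0; apply: IH => //.
suff : (val w < val w')%N.
  have wb : all (fun i => i < b)%N w' by rewrite (perm_all _ w'w0).
  have := val_lt _ wb; rewrite (perm_size w'w0) -/n; lia.
have := perm_size w'w; have wb : all (fun i => i < b)%N w by rewrite (perm_all _ ww0).
case: lt wb => [c [i [j [r [r' [-> -> ij]]]]]]; rewrite all_cat /= => /and3P[_ _ rb].
rewrite !size_cat => /addnI /= [sz]; rewrite /val !foldl_cat /= !foldE -!/val sz.
have := val_lt _ rb => {foldE}; have : (i.+1 * b ^ size r <= j * b ^ size r)%N by rewrite leq_mul2r ij orbT.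
rewrite !mulnDl mulSn.
set X := (_ * _ * _)%N; lia.
Qed.

Definition flat (bs : seq (nat * seq nat)) : seq nat := flatten [seq b.1 :: b.2 | b <- bs].

Lemma flat_cons b bs : flat (b :: bs) = (b.1 :: b.2) ++ flat bs.
Proof. by []. Qed.

(** A block (a, v) stands for the word a v and for the commutator [a, v]. *)
Fixpoint head_minimal (bs : seq (nat * seq nat)) : bool :=
  if bs is b :: bs' then all (ltn b.1) (b.2 ++ flat bs') && head_minimal bs' else true.

Definition has_chain (k : nat) (w : seq nat) : Prop :=
  exists p bs r, [/\ w = p ++ flat bs ++ r, size bs = k & head_minimal bs].

Section Straightening.
Variables (K : fieldType) (A : lieAlgType K) (x : nat -> A).

Definition block_val (b : nat * seq nat) : A := act x (x b.1) b.2.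
Definition act_blocks (t : A) (bs : seq (nat * seq nat)) : A :=
  foldl (fun t b => lie t (block_val b)) t bs.

Definition perm_span t w := lspan [set act x t w' | w' in [set w' | perm_eq w' w]].
Definition greater_span t w :=
  lspan [set act x t w' | w' in [set w' | perm_eq w' w /\ lexlt w w']].

Lemma act_blocks_lin bs : linear (fun t => act_blocks t bs).
Proof.
elim/last_ind: bs => // w i IH c u v.
by rewrite /act_blocks -cats1 !foldl_cat /= -!/(act_blocks _ _) IH liePl.
Qed.

Lemma lie_block_rcons t a v b :
  lie t (block_val (a, rcons v b)) = lie (lie t (block_val (a, v))) (x b) - lie (lie t (x b)) (block_val (a, v)).
Proof.
by rewrite /block_val /= -cats1 act_cat [LHS]lie_lie.
Qed.

Lemma lie_block_perm t b : perm_span t (b.1 :: b.2) (lie t (block_val b)).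
Proof.
case: b => a v /=; elim/last_ind: v t => [|v b IH] t.
  by apply: lspan_gen; exists [:: a] => /=.
rewrite lie_block_rcons; apply: lspanB.
  apply: (lspan_map (f := fun u => lie u (x b))) (IH t) => [c u u'|_ [w /= wp <-]].
    by rewrite liePl.
  apply: lspan_gen; exists (rcons w b); last by rewrite -cats1 act_cat.
  by rewrite /= -rcons_cons -!cats1 perm_cat2r.
apply: lspan_sub (IH (lie t (x b))) => _ [w /= wp <-].
apply: lspan_gen; exists (b :: w) => //=.
by rewrite -rcons_cons perm_sym perm_rcons perm_cons perm_sym.
Qed.

(** Up to larger words, acting by [a, v] is acting by the letters of a v one after the
    other: the other terms of the expansion begin with a letter of v. *)
Lemma lie_block_lead t b : all (ltn b.1) b.2 ->
  greater_span t (b.1 :: b.2) (lie t (block_val b) - act x t (b.1 :: b.2)).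
Proof.
case: b => a v /=; elim/last_ind: v t => [|v b IH] t.
  by move=> _; rewrite /block_val /= subrr; exact: lspan0.
rewrite all_rcons => /andP[ab av]; rewrite lie_block_rcons addrAC; apply: lspanB.
  rewrite -rcons_cons -cats1 act_cat /= -lieNl -lieDl.
  apply: (lspan_map (f := fun u => lie u (x b))) (IH t av) => [c u u'|_ [w /= [wp wl] <-]].
    by rewrite liePl.
  apply: lspan_gen; exists (w ++ [:: b]); last by rewrite act_cat.
  rewrite -cat_cons; split; first by rewrite perm_cat2r.
  exact: (@lexlt_cat [::] _ _ _ _ wl).
apply: lspan_sub (lie_block_perm (lie t (x b)) (a, v)) => _ [w /= wp <-].
apply: lspan_gen; exists (b :: w) => //=; split; last exact: lexlt_head.
by rewrite -rcons_cons perm_sym perm_rcons perm_cons perm_sym.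
Qed.

Lemma act_blocks_perm t bs : perm_span t (flat bs) (act_blocks t bs).
Proof.
elim: bs t => [|b bs IH] t; first by apply: lspan_gen; exists [::].
apply: (lspan_map (@act_blocks_lin bs)) (lie_block_perm t b) => _ [w /= wp <-].
apply: lspan_sub (IH (act x t w)) => _ [w' /= wp' <-].
by apply: lspan_gen; exists (w ++ w'); rewrite ?act_cat //= perm_cat.
Qed.

(** Once a prefix is larger, whatever follows it does not matter. *)
Lemma act_blocks_cons_greater t b b' bs bs' :
  greater_span t (b.1 :: b.2) b' -> perm_eq (flat bs') (flat bs) ->
  greater_span t (flat (b :: bs)) (act_blocks b' bs').
Proof.
move=> tb bbs; apply: (lspan_map (@act_blocks_lin bs')) tb => _ [w /= [wp wl] <-].
apply: lspan_sub (act_blocks_perm (act x t w) bs') => _ [w' /= wp' <-].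
apply: lspan_gen; exists (w ++ w'); rewrite ?act_cat //=; split.
  by rewrite flat_cons perm_cat // (perm_trans wp').
exact: (@lexlt_cat [::] _ _ _ _ wl).
Qed.

Lemma greater_span_cat t u w g : greater_span (act x t u) w g -> greater_span t (u ++ w) g.
Proof.
apply: lspan_sub => _ [w' /= [wp' wl] <-].
apply: lspan_gen; exists (u ++ w'); rewrite ?act_cat //=; split; first by rewrite perm_cat2l.
by have := @lexlt_cat u _ _ [::] [::] wl; rewrite !cats0.
Qed.

Lemma act_blocks_lead t bs : head_minimal bs -> greater_span t (flat bs) (act_blocks t bs - act x t (flat bs)).
Proof.
elim: bs t => [|b bs IH] t /=; first by rewrite /act_blocks /= subrr => _; exact: lspan0.
rewrite all_cat => /andP[/andP[bb _] gbs].
have -> : act_blocks (lie t (block_val b)) bs - act x t (flat (b :: bs)) =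
    act_blocks (lie t (block_val b) - act x t (b.1 :: b.2)) bs +
    (act_blocks (act x t (b.1 :: b.2)) bs - act x (act x t (b.1 :: b.2)) (flat bs)).
  have [_ fD fN _] := linear_facts (@act_blocks_lin bs).
  by rewrite fD fN addrA subrK -act_cat.
apply: lspanD; first exact: act_blocks_cons_greater (lie_block_lead _ bb) (perm_refl _).
by apply: (@greater_span_cat t (b.1 :: b.2)); exact: IH.
Qed.

Lemma perm_flat bs bs' : perm_eq bs bs' -> perm_eq (flat bs) (flat bs').
Proof. by move=> h; apply: perm_flatten; exact: perm_map. Qed.

(** At the first place where the two sequences of blocks differ, the permuted one
    has a block from further right, all of whose letters exceed the head that
    stands there in [bs]. *)
Lemma act_blocks_perm_greater t bs bs' : head_minimal bs -> perm_eq bs' bs -> bs' != bs ->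
  greater_span t (flat bs) (act_blocks t bs').
Proof.
elim: bs bs' t => [|b bs IH] bs' t; first by move=> _ /perm_nilP ->.
case: bs' => [|b' bs']; first by move=> _ /perm_size.
move=> /andP[]; rewrite all_cat => /andP[bb bbs] gbs pbs.
have [e|b'b] := eqVneq b' b.
  move: pbs; rewrite e perm_cons eqseq_cons eqxx /= => pbs nbs.
  rewrite /act_blocks /= -/(act_blocks _ _).
  rewrite -[lie t (block_val b)](subrK (act x t (b.1 :: b.2))).
  have [_ fD fN _] := linear_facts (@act_blocks_lin bs'); rewrite fD; apply: lspanD.
    exact: act_blocks_cons_greater (lie_block_lead _ bb) (perm_flat pbs).
  by apply: (@greater_span_cat t (b.1 :: b.2)); exact: IH.
move=> _; have b'bs : b' \in bs.
  by have := mem_head b' bs'; rewrite (perm_mem pbs) inE (negPf b'b).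
have lt : all (ltn b.1) (b'.1 :: b'.2).
  apply/allP => i ib; apply: (allP bbs); apply/flattenP.
  by exists (b'.1 :: b'.2) => //; apply: map_f.
apply: (lspan_map (@act_blocks_lin bs')) (lie_block_perm t b') => _ [w /= wp <-].
apply: lspan_sub (act_blocks_perm (act x t w) bs') => _ [w' /= wp' <-].
apply: lspan_gen; exists (w ++ w'); rewrite ?act_cat //=; split.
  by rewrite (perm_trans _ (perm_flat pbs)) // flat_cons perm_cat.
move: lt; rewrite -(perm_all _ wp); move: (perm_size wp).
by case: w {wp wp'} => //= i w _ /andP[bi _]; exact: lexlt_head.
Qed.

Lemma head_minimal_uniq bs : head_minimal bs -> uniq bs.
Proof.
elim: bs => //= b bs IH /andP[]; rewrite all_cat => /andP[_ bbs] /IH ->; rewrite andbT.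
apply/negP => bin; suff /(allP bbs) /= : b.1 \in flat bs by rewrite /ltn /= ltnn.
by apply/flattenP; exists (b.1 :: b.2); rewrite ?mem_head //; exact: map_f.
Qed.

Variables (M : nat) (l : seq (K * seq nat)).
Hypothesis lP : forall p, p \in l -> perm_eq p.2 (iota 0 M) /\ p.2 != iota 0 M.
Hypothesis lE : forall t (y : nat -> A),
  act y t (iota 0 M) = \sum_(p <- l) p.1 *: act y t p.2.

(** The multilinear identity, applied to the values of the blocks of a chain. *)
Lemma chain_greater t w : has_chain M w -> greater_span t w (act x t w).
Proof.
move=> [p [bs [r [-> szbs gbs]]]].
have H t' : greater_span t' (flat bs) (act x t' (flat bs)).
  rewrite -[X in greater_span _ _ X](subrK (act_blocks t' bs)); apply: lspanD.
    by rewrite -opprB -scaleN1r; apply: lspanZ; exact: act_blocks_lead.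
  pose y j := block_val (nth (0%N, [::]) bs j).
  have yE s u : act y u s = act_blocks u [seq nth (0%N, [::]) bs j | j <- s].
    by elim: s u => //= j s IH u; rewrite /act /= -/(act _ _ _) IH.
  have iE : [seq nth (0%N, [::]) bs j | j <- iota 0 M] = bs.
    by rewrite -szbs map_nth_iota0 ?take_size.
  rewrite -[X in act_blocks _ X]iE -yE lE; apply: lspan_sum => q ql.
  have [qp qn] := lP ql; apply: lspanZ; rewrite yE; apply: act_blocks_perm_greater => //.
    by rewrite -[X in perm_eq _ X]iE perm_map.
  rewrite -[X in _ != X]iE; apply: contra qn => /eqP e; apply/eqP.
  apply: (@eq_from_nth _ 0%N); rewrite (perm_size qp) // => i isz.
  have := congr1 (fun s => nth (0%N, [::]) s i) e.
  rewrite !(nth_map 0%N) ?(perm_size qp) //.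
  have lt s : perm_eq s (iota 0 M) -> (nth 0%N s i < size bs)%N.
    move=> sM; have : nth 0%N s i \in s by rewrite mem_nth // (perm_size sM).
    by rewrite (perm_mem sM) mem_iota szbs.
  by move=> /eqP; rewrite nth_uniq ?lt ?head_minimal_uniq // => /eqP.
rewrite act_cat; apply: greater_span_cat; rewrite act_cat.
apply: (lspan_map (act_lin x r)) (H (act x t p)) => _ [w' /= [wp wl] <-].
apply: lspan_gen; exists (w' ++ r); rewrite ?act_cat //; split; first by rewrite perm_cat2r.
exact: (@lexlt_cat [::] _ _ _ _ wl).
Qed.

Theorem act_span_no_chain t w :
  lspan [set act x t w' | w' in [set w' | perm_eq w' w /\ ~ has_chain M w']] (act x t w).
Proof.
elim/lex_ind: w => w IH.
have [wc|wc] := pselect (has_chain M w); last by apply: lspan_gen; exists w.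
apply: lspan_sub (chain_greater t wc) => _ [w' /= [wp wl] <-].
apply: lspan_mono (IH w' wp wl) => _ [u /= [up uc] <-]; exists u => //.
by split=> //; exact: perm_trans up wp.
Qed.

End Straightening.

(** * Words without long chains, and the codimension bound *)

Fixpoint splits (T : Type) (s : seq T) : seq (seq T * seq T) :=
  if s is a :: s' then
    [seq (a :: p.1, p.2) | p <- splits s'] ++ [seq (p.1, a :: p.2) | p <- splits s']
  else [:: ([::], [::])].

Lemma mem_splits (T : eqType) (b : pred T) s :
  ([seq i <- s | b i], [seq i <- s | ~~ b i]) \in splits s.
Proof.
elim: s => //= a s IH; rewrite mem_cat.
case: (b a) => /=; apply/orP; [left|right].
  by apply/mapP; eexists; first exact: IH.
by apply/mapP; eexists; first exact: IH.
Qed.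

Lemma sum_splits (R : pzRingType) (T : Type) (H : nat -> nat -> R) (s : seq T) :
  \sum_(p <- splits s) H (size p.1) (size p.2) =
  \sum_(i < (size s).+1) H i (size s - i)%N *+ 'C(size s, i).
Proof.
elim: s H => [|a s IH] H /=; first by rewrite big_seq1 big_ord1 bin0.
rewrite big_cat !big_map /= (IH (fun i j => H i.+1 j)) (IH (fun i j => H i j.+1)).
rewrite [RHS]big_ord_recl bin0 subn0 mulr1n.
under [in RHS]eq_bigr => i _ do rewrite binS mulrnDr subSS.
rewrite big_split /= addrA [RHS]addrC; congr (_ + _).
rewrite [LHS]big_ord_recl bin0 subn0 mulr1n [X in _ = _ + X]big_ord_recr /= bin_small //.
rewrite mulr0n addr0; congr (_ + _); apply: eq_bigr => i _.
by rewrite subnSK.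
Qed.

(** The common shape of the two enumerations below, words and spanning products:
    split off the least letter [a] of a sorted sequence, distribute the remaining
    letters between an object of the same kind and an inner object attached to
    [a].  The number [n] bounds the depth of the recursion. *)
Section Assemble.
Variables (T U : Type) (comb : T -> nat -> U -> T) (t0 : T) (inner : seq nat -> seq U).

Fixpoint assemble (n : nat) (s : seq nat) : seq T :=
  match n, s with
  | _, [::] => [:: t0]
  | 0, _ => [::]
  | n'.+1, a :: s' =>
      flatten [seq [seq comb t a v | t <- assemble n' p.1, v <- inner p.2] | p <- splits s']
  end.

(** The recursion is the coefficient form of e' = e f, with binomial coefficients
    absorbed in the factorials; an inequality e' >= e f is enough. *)
Lemma size_assemble (R : realFieldType) (e f : nat -> R) :
  1 <= e 0%N -> (forall n, 0 <= e n) ->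
  (forall n, \sum_(i < n.+1) e i * f (n - i)%N <= n.+1%:R * e n.+1) ->
  (forall s, (size (inner s))%:R <= (size s)`!%:R * f (size s)) ->
  forall n s, (size (assemble n s))%:R <= (size s)`!%:R * e (size s).
Proof.
move=> e0 epos ef inner_le; elim=> [|n IH] [|a s] /=; rewrite ?fact0 ?mul1r //.
  by rewrite mulr_ge0 ?ler0n.
rewrite size_flatten /shape -map_comp sumnE big_map natr_sum.
apply: (@le_trans _ _ (\sum_(p <- splits s)
    ((size p.1)`!%:R * e (size p.1)) * ((size p.2)`!%:R * f (size p.2)))).
  by apply: ler_sum => p _ /=; rewrite size_allpairs natrM ler_pM.
rewrite (sum_splits (fun i j => (i`!%:R * e i) * (j`!%:R * f j))).
rewrite factS natrM mulrC mulrA mulrC [X in _ * X]mulrC.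
apply: le_trans (ler_wpM2l _ (ef (size s))) => //.
rewrite mulr_sumr ler_sum // => i _.
rewrite -(bin_fact (n := size s) (m := i)) -1?ltnS // -mulr_natl !natrM.
by rewrite le_eqVlt; apply/orP; left; apply/eqP; ring.
Qed.
End Assemble.

Lemma mem_assemble (T : eqType) (U : eqType) (comb : T -> nat -> U -> T) t0 inner n a s p q t v :
  (p, q) \in splits s -> t \in assemble comb t0 inner n p -> v \in inner q ->
  comb t a v \in assemble comb t0 inner n.+1 (a :: s).
Proof.
move=> pq tp vq /=; apply/flatten_mapP; exists (p, q) => //=.
by apply/allpairsP; exists (t, v).
Qed.

(** Meant to contain every word on the sorted letters [s] that has no chain of [k.+1]
    heads; see [mem_words]. *)
Fixpoint words (k : nat) (s : seq nat) : seq (seq nat) :=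
  if k is k'.+1 then
    assemble (fun u a v => u ++ a :: v) [::] (words k') (size s) s
  else if s is [::] then [:: [::]] else [::].

Lemma has_chain_cat k p w r : has_chain k w -> has_chain k (p ++ w ++ r).
Proof.
move=> [p' [bs [r' [-> sz gbs]]]]; exists (p ++ p'), bs, (r' ++ r).
by rewrite -!catA.
Qed.

(** The last letter of [a :: p] below the first head of the chain, where [p] is what
    precedes the chain in [v], is a new head: what separates it from the chain is
    not below the first head. *)
Lemma has_chain_min k a v : all (ltn a) v -> has_chain k v -> has_chain k.+1 (a :: v).
Proof.
move=> av [p [[|b bs] [r [vE sz gbs]]]].
  by exists [::], [:: (a, [::])], v; split=> //=; rewrite -sz.
have ab : (a < b.1)%N.
  by apply: (allP av); rewrite vE mem_cat flat_cons -catA mem_cat mem_head orbT.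
have [p1 [d [p2 [pE db p2b]]]] : exists p1 d p2,
    [/\ a :: p = p1 ++ d :: p2, (d < b.1)%N & all (leq b.1) p2].
  elim/last_ind: p {vE} => [|p e [p1 [d [p2 [pE db p2b]]]]].
    by exists [::], a, [::].
  have [eb|eb] := ltnP e b.1.
    by exists (a :: p), e, [::]; rewrite -cats1.
  by exists p1, d, (rcons p2 e); rewrite -rcons_cons pE rcons_cat all_rcons eb.
exists p1, ((d, p2) :: b :: bs), r; split; last 2 first.
- by rewrite /= -sz.
- move: gbs; rewrite [head_minimal (b :: bs)]/= => gbs; rewrite [head_minimal _]/= gbs andbT.
  have /andP[bb _] := gbs; rewrite flat_cons all_cat all_cat /= db /= -all_cat.
  apply/andP; split; apply/allP => i; first by move=> /(allP p2b) /= h; exact: leq_trans h.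
  by move=> /(allP bb) /= h; exact: ltn_trans h.
by rewrite vE -cat_cons pE (flat_cons (d, p2)) -!catA.
Qed.

(** Cut [w] at its least letter, as u a v: a chain of [k.+1] heads in v would give one of
    [k.+2] heads in [w]. *)
Lemma mem_words k s w : sorted ltn s -> perm_eq w s -> ~ has_chain k.+1 w -> w \in words k s.
Proof.
elim: k s w => [|k IHk] s w.
  case: w => [|i w] _; first by rewrite perm_sym => /perm_nilP ->.
  by move=> _ []; exists [::], [:: (i, [::])], w.
rewrite [words _ _]/=; move: (leqnn (size s)); move: {-1}(size s) => n.
elim: n s w => [|n IHn] [|a s] w // sn ss ws nc.
- by move: ws => /perm_nilP ->; rewrite inE.
- by move: ws => /perm_nilP ->; rewrite inE.
have aw : a \in w by rewrite (perm_mem ws) mem_head.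
case/splitPr: aw ws nc => u v ws nc.
have {}ws : perm_eq (u ++ v) s by move: ws; rewrite -(cat1s a v) perm_catCA /= perm_cons.
have := ss; rewrite /= path_sortedE => [/andP[las {}ss]|]; last exact: ltn_trans.
have us : uniq (u ++ v) by rewrite (perm_uniq ws); apply: sorted_uniq ss; [exact: ltn_trans|exact: ltnn].
move: us; rewrite cat_uniq => /and3P[uu /hasPn uv vu].
pose p := [seq i <- s | i \in u]; pose q := [seq i <- s | i \notin u].
have su : uniq s by apply: sorted_uniq ss; [exact: ltn_trans|exact: ltnn].
have pu : perm_eq u p.
  apply: uniq_perm; rewrite ?filter_uniq // => i.
  by rewrite mem_filter -(perm_mem ws) mem_cat; case: (i \in u).
have qv : perm_eq v q.
  apply: uniq_perm; rewrite ?filter_uniq // => i.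
  rewrite mem_filter -(perm_mem ws) mem_cat; case iu: (i \in u) => //=.
  by apply/negP => /uv; rewrite /= iu.
apply: (@mem_assemble _ _ (fun u a v => u ++ a :: v) [::] (words k) n a s p q u v); first exact: mem_splits.
  apply: IHn => //; first by rewrite size_filter (leq_trans (count_size _ _)).
    by apply: sorted_filter ss; exact: ltn_trans.
  by move=> /(@has_chain_cat _ [::] _ (a :: v)).
apply: IHk => //; first by apply: sorted_filter ss; exact: ltn_trans.
move=> vc; apply: nc; have := @has_chain_cat k.+2 u (a :: v) [::].
rewrite cats0; apply; apply: has_chain_min => //.
by apply/allP => i iv; apply: (allP las); rewrite -(perm_mem ws) mem_cat iv orbT.
Qed.

HB.instance Definition _ (K : fieldType) (A : poissonAlgType K) :=
  Monoid.isComLaw.Build A pone pmul pmulA pmulC pmul1.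

Section PoissonSpan.
Variables (K : fieldType) (A : poissonAlgType K) (x : nat -> A) (k : nat).

Definition poisson_gens (s : seq nat) : seq A :=
  assemble (fun e a v => pmul e (act x (x a) v)) pone (words k) (size s) s.

Definition monomial_val (cs : seq commutator) : A := \big[pmul/pone]_(c <- cs) ceval x c.

Hypothesis no_chain : forall t w,
  lspan [set act x t w' | w' in [set w' | perm_eq w' w /\ ~ has_chain k.+1 w']] (act x t w).

Lemma ceval_words c a s : sorted ltn s -> perm_eq (letters c) (a :: s) -> a \notin s ->
  lspan [set act x (x a) v | v in [set v | v \in words k s]] (ceval x c).
Proof.
move=> ss cs as_; rewrite (@ceval_left_normed _ _ _ _ a); last first.
  by move: cs => /permP ->; rewrite /= eqxx (count_memPn as_).
apply: lspan_sum => p pc; case: eqP => [ha|_]; last by rewrite mul0r scale0r; exact: lspan0.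
apply: lspanZ; have := perm_trans (expand_perm pc) cs; have := expand_nil pc.
case: p.2 ha => //= i v -> _; rewrite perm_cons => vs.
apply: lspan_mono (no_chain (x a) v) => _ [w /= [wv wc] <-]; exists w => //=.
by apply: mem_words => //; exact: perm_trans wv vs.
Qed.

(** The factor that contains the least letter [a] of [s] is a combination of
    commutators [a, v]; the other factors form a monomial on fewer letters. *)
Lemma monomial_val_span s cs : sorted ltn s -> perm_eq (flatten [seq letters c | c <- cs]) s ->
  lspan [set` poisson_gens s] (monomial_val cs).
Proof.
have nilP cs' : perm_eq (flatten [seq letters c | c <- cs']) [::] -> cs' = [::].
  by case: cs' => //= c cs' /perm_size; rewrite size_cat /=; have := size_letters_gt0 c; lia.
rewrite /poisson_gens; move: (leqnn (size s)); move: {-1}(size s) => n.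
elim: n s cs => [|n IH] [|a s] cs // sn ss css.
- by rewrite (nilP _ css) /monomial_val big_nil; apply: lspan_gen; rewrite /= inE.
- by rewrite (nilP _ css) /monomial_val big_nil; apply: lspan_gen; rewrite /= inE.
have /flattenP[lc /mapP[c ccs ->] ac] : a \in flatten [seq letters c | c <- cs].
  by rewrite (perm_mem css) mem_head.
have cs_perm := perm_to_rem ccs; set ds := rem c cs in cs_perm.
rewrite /monomial_val (perm_big _ cs_perm) big_cons -/(monomial_val ds).
have {}css : perm_eq (letters c ++ flatten [seq letters c | c <- ds]) (a :: s).
  apply: perm_trans css; rewrite perm_sym.
  exact: (perm_flatten (perm_map letters cs_perm)).
have := ss; rewrite /= path_sortedE => [/andP[las {}ss']|]; last exact: ltn_trans.
have uas : uniq (a :: s) by apply: sorted_uniq ss; [exact: ltn_trans|exact: ltnn].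
have := uas; rewrite -(perm_uniq css) cat_uniq => /and3P[uc /hasPn uv vu].
have /andP[as_ us] := uas.
pose q := [seq i <- s | i \in letters c]; pose p := [seq i <- s | i \notin letters c].
have cq : perm_eq (letters c) (a :: q).
  apply: uniq_perm; rewrite //= ?mem_filter ?(negPf as_) ?andbF ?filter_uniq // => i.
  rewrite inE mem_filter; case: eqVneq => [->|ia] //=.
  case ic : (i \in letters c) => //=.
  have : i \in a :: s by rewrite -(perm_mem css) mem_cat ic.
  by rewrite inE (negPf ia) /= => ->.
have dp : perm_eq (flatten [seq letters c | c <- ds]) p.
  apply: uniq_perm; rewrite ?filter_uniq // => i; rewrite mem_filter.
  case ic : (i \in letters c) => /=; first by apply/negP => /uv; rewrite /= ic.
  have := perm_mem css i; rewrite mem_cat ic inE /= => ->.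
  by case: eqP => // ia; rewrite ia ac in ic.
have pq : (p, q) \in splits s.
  have := mem_splits (fun i => i \notin letters c) s.
  suff -> : [seq i <- s | ~~ (i \notin letters c)] = q by [].
  by apply: eq_filter => i; rewrite negbK.
have sq : sorted ltn q by apply: sorted_filter ss'; exact: ltn_trans.
have sp : sorted ltn p by apply: sorted_filter ss'; exact: ltn_trans.
have aq : a \notin q by rewrite mem_filter (negPf as_) andbF.
have pn : (size p <= n)%N by rewrite size_filter (leq_trans (count_size _ _)).
have mlin (u : A) : linear (pmul u) by move=> e y z; rewrite pmulPr.
have mlin' (u : A) : linear (fun y => pmul y u) by move=> e y z; rewrite pmulPl.
apply: (lspan_map (mlin' (monomial_val ds))) (ceval_words sq cq aq) => _ [v /= vq <-].
apply: (lspan_map (mlin (act x (x a) v))) (IH p ds pn sp dp) => e /= ep.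
apply: lspan_gen => /=; rewrite pmulC.
exact: (@mem_assemble _ _ (fun e a v => pmul e (act x (x a) v)) pone (words k) n a s p q e v).
Qed.

End PoissonSpan.

Lemma poisson_hom_comm_val (K : fieldType) (A : poissonAlgType K)
    (h : free_poisson K -> A) (x : nat -> A) c :
  poisson_hom h -> (forall i, h (poisson_var K i) = x i) ->
  h (sym_inj (comm_val K c)) = ceval x c.
Proof.
move=> [_ _ _ hl] hx; elim: c => [i|u IHu v IHv] /=; first exact: hx.
by rewrite -IHu -IHv -hl [lie (sym_inj _) _]sym_lie_inj.
Qed.

(** The relatively free algebra of W belongs to W, hence satisfies the identity for
    arbitrary values of the variables. *)
Theorem codim_le_size_poisson_gens (K : fieldType) (W : poissonAlgType K -> Prop) (k n : nat)
    (f : free_lie K) :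
  is_variety W -> has_lie_degree f k.+2 ->
  (forall A, W A -> satisfies A (sym_inj f)) ->
  (codim W n <= size (poisson_gens (fun i => relfree_pi W (poisson_var K i)) k (iota 1 n)))%N.
Proof.
move=> Wvar fdeg fW; set x := fun i => _.
have [fs [fss fE [w wm wc]]] := top_word fdeg.
have [l [lP lE]] := left_normed_identity wm fss wc.
have idA (y : nat -> relfree W) : \sum_(p <- fs) p.1 *: ceval y p.2 = 0.
  have [h [[hh hy] _]] := free_poisson_universal y.
  transitivity (h (sym_inj f)); last exact: fW (relfree_in_variety Wvar) h hh.
  rewrite fE.
  have [hlin _ _ _] := hh; have [h0 hD _ hZ] := linear_facts hlin.
  have [i0 iD _ iZ] := linear_facts (@sym_injP K (free_lie K)).
  elim: (fs) => [|p r IH]; first by rewrite !big_nil i0 h0.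
  by rewrite !big_cons iD hD IH iZ hZ (poisson_hom_comm_val _ hh hy).
have nc := act_span_no_chain x lP (lE _ idA).
have pihom := relfree_pi_hom W; have [plin p1 pM _] := pihom.
have [p0 pD _ pZ] := linear_facts plin.
have [b [bfree bspan]] := codim_has_dim W n.
apply: (lspan_lfree_le bfree) => i.
have : lspan (range b) (b i) by apply: lspan_gen; exists i.
rewrite bspan => -[g gn <-]; move: g gn; apply: lspan_map => // _ [s /= sn <-].
rewrite (_ : relfree_pi W (mon_val K s) = monomial_val x s).
  by apply: monomial_val_span => //; exact: iota_ltn_sorted.
rewrite /mon_val /monomial_val; elim: (s) => [|c r IH]; first by rewrite !big_nil p1.
by rewrite !big_cons pM IH (poisson_hom_comm_val _ pihom (x := x)).
Qed.

(** * The iterated exponential series *)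

Section Series.
Variable R : realType.
Implicit Types (a b g : nat -> R).

Let trunc N a : {poly R} := \poly_(i < N) a i.

Lemma fps_mul_ge0 a b : (forall n, 0 <= a n) -> (forall n, 0 <= b n) ->
  forall n, 0 <= fps_mul a b n.
Proof. by move=> a0 b0 n; apply: sumr_ge0 => i _; exact: mulr_ge0. Qed.

Lemma fps_pow_ge0 a k : (forall n, 0 <= a n) -> forall n, 0 <= fps_pow a k n.
Proof.
move=> a0; elim: k => [|k IH] n; first by rewrite /fps_pow /= /fps_one ler0n.
exact: fps_mul_ge0.
Qed.

Lemma fps_exp_ge0 a : (forall n, 0 <= a n) -> forall n, 0 <= fps_exp a n.
Proof.
move=> a0 n; apply: sumr_ge0 => k _.
by rewrite divr_ge0 ?fps_pow_ge0.
Qed.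

Lemma fps_mul_X a n : fps_mul (@fps_X R) a n = if n is n'.+1 then a n' else 0.
Proof.
case: n => [|n]; first by rewrite /fps_mul big_ord1 /fps_X mul0r.
rewrite /fps_mul 2!big_ord_recl big1 /fps_X /= ?mul0r ?add0r ?mul1r ?addr0 ?subn1 //.
by move=> i _; rewrite mul0r.
Qed.

Lemma fps_powE N a k n : (n < N)%N -> fps_pow a k n = (trunc N a ^+ k)`_n.
Proof.
elim: k n => [|k IH] n nN; first by rewrite expr0 coef1.
rewrite exprS coefM; apply: eq_bigr => i _.
have iN : (i < N)%N by apply: leq_trans nN; rewrite ltn_ord.
by rewrite coef_poly iN -IH // (leq_ltn_trans (leq_subr _ _)).
Qed.

Lemma fps_pow_small a k n : a 0%N = 0 -> (n < k)%N -> fps_pow a k n = 0.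
Proof.
move=> a0; elim: k n => // k IH n nk.
rewrite /fps_pow /= -/(fps_pow a k) /fps_mul big_ord_recl a0 mul0r add0r big1 // => i _.
by rewrite IH ?mulr0 // /= /bump /=; move: nk (ltn_ord i); lia.
Qed.

(** The rule (exp g)' = g' exp g, read off on polynomial truncations of g. *)
Lemma fps_exp_deriv g n : g 0%N = 0 ->
  n.+1%:R * fps_exp g n.+1 = \sum_(i < n.+1) i.+1%:R * g i.+1 * fps_exp g (n - i)%N.
Proof.
move=> g0; pose p := trunc n.+2 g.
have powE k i : (i < n.+2)%N -> fps_pow g k i = (p ^+ k)`_i by move=> h; rewrite -fps_powE.
rewrite /fps_exp mulr_sumr big_ord_recl.
rewrite (_ : fps_pow g _ _ = 0) // mul0r mulr0 add0r.
transitivity (\sum_(k < n.+1) (p^`() * p ^+ k)`_n / k`!%:R).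
  apply: eq_bigr => k _; rewrite lift0 powE //.
  have : ((p ^+ k.+1)^`())`_n = (p ^+ k.+1)`_n.+1 *+ n.+1 by rewrite coef_deriv.
  rewrite deriv_exp /= coefMn -[RHS]mulr_natl -[LHS]mulr_natl => e.
  have f0 : k`!%:R != 0 :> R by rewrite pnatr_eq0 -lt0n fact_gt0.
  have k0 : k.+1%:R != 0 :> R by rewrite pnatr_eq0.
  rewrite mulrA -e factS natrM; field.
  by rewrite f0 addrC natr1.
under eq_bigr do rewrite coefM mulr_suml.
rewrite exchange_big; apply: eq_bigr => i _.
have i2 : (i.+1 < n.+2)%N by rewrite ltnS ltn_ord.
rewrite mulr_sumr (big_ord_widen n.+1 (fun k => i.+1%:R * g i.+1 * (fps_pow g k (n - i)%N / k`!%:R))); last by rewrite ltnS leq_subr.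
rewrite [RHS]big_mkcond; apply: eq_bigr => k _.
rewrite coef_deriv coef_poly i2 -powE ?ltnS; last by rewrite (leq_trans (leq_subr _ _)).
case: leqP => [_|ki]; first by rewrite -[g _ *+ _]mulr_natl -!mulrA.
by rewrite fps_pow_small // mulr0 mul0r.
Qed.

(** The tower of exponentials, started one step earlier, at the series 1; this is
    where the recursions on chains start. *)
Fixpoint exp_iter (k : nat) : nat -> R :=
  if k is j.+1 then fps_exp (fps_mul (@fps_X R) (exp_iter j)) else @fps_one R.

Lemma exp_iter_tower k : exp_iter k.+1 = exp_tower R k.
Proof.
elim: k => [|k IH]; last by rewrite /= -IH.
rewrite /=; congr fps_exp; apply/funext => -[|n]; first by rewrite fps_mul_X.
by rewrite fps_mul_X.
Qed.

Lemma exp_iter_ge0 k n : 0 <= exp_iter k n.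
Proof.
elim: k n => [|k IH] n /=; first by rewrite /fps_one ler0n.
by apply: fps_exp_ge0 => {}n; rewrite fps_mul_X; case: n.
Qed.

Lemma exp_iter0 k : exp_iter k 0%N = 1.
Proof.
by case: k => [|k] //=; rewrite /fps_exp big_ord1 /fps_pow /= /fps_one fact0 divr1.
Qed.

(** E_(k+1)' = (z E_k)' E_(k+1), and the coefficients of (z E_k)' dominate those of
    E_k. *)
Lemma exp_iter_conv k n :
  \sum_(i < n.+1) exp_iter k.+1 i * exp_iter k (n - i)%N <= n.+1%:R * exp_iter k.+1 n.+1.
Proof.
rewrite [exp_iter k.+1 n.+1]/= fps_exp_deriv; last by rewrite fps_mul_X.
(* The convolution is stated with the factors in the other order. *)
rewrite (reindex_inj rev_ord_inj) /=; apply: ler_sum => i _.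
rewrite subSS subKn; last by rewrite -ltnS.
rewrite mulrC fps_mul_X ler_wpM2r //; first exact: (exp_iter_ge0 k.+1).
by rewrite ler_peMl ?exp_iter_ge0 // ler1n.
Qed.

Lemma size_words k s : (size (words k s))%:R <= (size s)`!%:R * exp_iter k (size s).
Proof.
elim: k s => [|k IH] s.
  case: s => [|a s]; first by rewrite fact0 mul1r.
  by rewrite /= /fps_one mulr0.
apply: size_assemble IH _ _ => [|n|n]; first by rewrite exp_iter0.
  exact: exp_iter_ge0.
exact: exp_iter_conv.
Qed.

Lemma size_poisson_gens (K : fieldType) (A : poissonAlgType K) (x : nat -> A) k s :
  (size (poisson_gens x k s))%:R <= (size s)`!%:R * exp_iter k.+1 (size s).
Proof.
apply: size_assemble (size_words k) _ _ => [|n|n]; first by rewrite exp_iter0.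
  exact: exp_iter_ge0.
exact: exp_iter_conv.
Qed.

End Series.

(** * Growth of the coefficients *)

Section Asymptotics.
Variable R : realType.
Implicit Types (a : nat -> R) (r x : R).

Lemma expR_partial_sum r n : 0 <= r -> \sum_(k < n) r ^+ k / k`!%:R <= expR r.
Proof.
move=> r0; rewrite /expR.
apply: le_trans (nondecreasing_cvgn_le _ (is_cvg_series_exp_coeff r) n).
  by rewrite /series /= big_mkord.
apply: nondecreasing_series => k _ _.
by rewrite /exp_coeff /= divr_ge0 ?exprn_ge0.
Qed.

Lemma horner_partial_sum (p : {poly R}) r n : (forall i, 0 <= p`_i) -> 0 <= r ->
  \sum_(i < n) p`_i * r ^+ i <= p.[r].
Proof.
move=> p0 r0; rewrite (@horner_coef_wide _ (n + size p)) ?leq_addl //.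
rewrite big_split_ord /= lerDl sumr_ge0 // => i _.
by rewrite mulr_ge0 ?exprn_ge0.
Qed.

(** Partial sums suffice: a truncation of a bounds the coefficients of its powers that
    matter, and these powers evaluate to powers of the value of the truncation. *)
Lemma fps_exp_partial_sum a r s n : (forall i, 0 <= a i) -> 0 <= r ->
  \sum_(i < n) a i * r ^+ i <= s -> \sum_(i < n) fps_exp a i * r ^+ i <= expR s.
Proof.
move=> a0 r0 as_; pose p := \poly_(i < n) a i.
have pE : p.[r] = \sum_(i < n) a i * r ^+ i by rewrite horner_poly.
have p0 k i : 0 <= (p ^+ k)`_i.
  elim: k i => [|k IH] i; first by rewrite expr0 coef1 ler0n.
  rewrite exprS coefM sumr_ge0 // => j _; rewrite mulr_ge0 // coef_poly.
  by case: ifP.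
have pr0 : 0 <= p.[r] by rewrite pE sumr_ge0 // => i _; rewrite mulr_ge0 ?exprn_ge0.
apply: (@le_trans _ _ (expR p.[r])); last by rewrite ler_expR pE.
apply: le_trans (expR_partial_sum n pr0).
apply: (@le_trans _ _ (\sum_(i < n) \sum_(k < n) (p ^+ k)`_i / k`!%:R * r ^+ i)).
  apply: ler_sum => i _; rewrite /fps_exp mulr_suml.
  rewrite (big_ord_widen n (fun k => fps_pow a k i / k`!%:R * r ^+ i)) //.
  rewrite big_mkcond; apply: ler_sum => k _; rewrite (@fps_powE _ n) //.
  by case: ifP => // _; rewrite mulr_ge0 ?divr_ge0 ?exprn_ge0.
rewrite exchange_big; apply: ler_sum => k _ /=.
have -> : p.[r] ^+ k = (p ^+ k).[r] by rewrite horner_exp.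
apply: le_trans (ler_wpM2r _ (horner_partial_sum n (p0 k) r0)); last by rewrite invr_ge0.
by rewrite mulr_suml; apply: ler_sum => i _; rewrite mulrAC.
Qed.

(** The sum at r of the series [exp_iter k]. *)
Fixpoint exp_val (k : nat) (r : R) : R :=
  if k is j.+1 then expR (r * exp_val j r) else 1.

Lemma exp_iter_partial_sum k r n : 0 <= r ->
  \sum_(i < n) exp_iter R k i * r ^+ i <= exp_val k r.
Proof.
move=> r0; elim: k n => [|k IH] n.
  case: n => [|n]; first by rewrite big_ord0.
  by rewrite big_ord_recl expr0 mulr1 big1 ?addr0 // => i _; rewrite mul0r.
apply: fps_exp_partial_sum => // [i|].
  by rewrite fps_mul_X; case: i => // i; exact: exp_iter_ge0.
case: n => [|n].
  rewrite big_ord0 mulr_ge0 //.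
  by have := IH 0%N; rewrite big_ord0.
rewrite big_ord_recl fps_mul_X mul0r add0r.
apply: le_trans (ler_wpM2l r0 (IH n)); rewrite mulr_sumr ler_sum // => i _.
by rewrite fps_mul_X lift0 exprS mulrCA.
Qed.

Lemma exp_iter_le k r n : 0 < r -> exp_iter R k n <= exp_val k r / r ^+ n.
Proof.
move=> r0; rewrite ler_pdivlMr ?exprn_gt0 //.
apply: le_trans (exp_iter_partial_sum k n.+1 (ltW r0)).
rewrite big_ord_recr /= lerDr sumr_ge0 // => i _.
by rewrite mulr_ge0 ?exprn_ge0 ?exp_iter_ge0 ?ltW.
Qed.

Lemma iter_lnSr k x : iter_ln k.+1 x = iter_ln k (ln x).
Proof. by rewrite /iter_ln iterSr. Qed.

Lemma iter_ln_large k (B : R) : exists X, forall x, X <= x -> B <= iter_ln k x /\ iter_ln k x <= x.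
Proof.
elim: k B => [|k IH] B; first by exists B.
have [X HX] := IH (expR (Num.max B 1)).
exists X => x /HX[h1 h2].
have g0 : 0 < iter_ln k x by apply: lt_le_trans h1; exact: expR_gt0.
rewrite /iter_ln iterS -/(iter_ln k x); split; last exact: le_trans (ltW (ln_sublinear g0)) h2.
have : Num.max B 1 <= ln (iter_ln k x) by rewrite -ler_expR lnK.
by apply: le_trans; rewrite le_max lexx.
Qed.

Lemma expR_beats_linear (c d : R) : 0 < c -> 0 < d ->
  exists X, forall y, X <= y -> y <= c * expR (d * y).
Proof.
move=> c0 d0; exists (2 / (c * d ^+ 2)) => y yX.
have y0 : 0 < y by apply: lt_le_trans yX; rewrite divr_gt0 ?mulr_gt0 ?exprn_gt0.
(* The quadratic term of the exponential series already beats y. *)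
apply: (@le_trans _ _ (c * ((d * y) ^+ 2 / 2))); last first.
  rewrite ler_pM2l //.
  by apply: le_trans (expR_ge1Dxn 1 (ltW (mulr_gt0 d0 y0))); rewrite lerDr.
move: yX; rewrite ler_pdivrMr ?mulr_gt0 ?exprn_gt0 // => yX.
rewrite exprMn [y ^+ 2]expr2; nra.
Qed.

(** Put y = ln x.  If r E_k(r) <= b y at r = t ln^(k) y, then
    E_(k+1)(r) <= exp(b y) = x^b, so r E_(k+1)(r) <= y x^b is o(x) as b < 1. *)
Lemma exp_val_iter_ln_step k (t b c : R) : 0 < t < 1 -> b < 1 -> 0 < c ->
  (exists X, forall x, X <= x ->
    t * iter_ln k x * exp_val k (t * iter_ln k x) <= b * x) ->
  exists X, forall x, X <= x ->
    t * iter_ln k.+1 x * exp_val k.+1 (t * iter_ln k.+1 x) <= c * x.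
Proof.
move=> /andP[t0 t1] b1 c0 [X HX].
have [Y HY] := iter_ln_large k 0.
have [Z HZ] : exists Z, forall y, Z <= y -> y <= c * expR ((1 - b) * y).
  by apply: expR_beats_linear; rewrite // subr_gt0.
exists (expR (Num.max X (Num.max Y Z))) => x xX.
have x0 : 0 < x by apply: lt_le_trans xX; exact: expR_gt0.
set y := ln x; have xE : x = expR y by rewrite lnK.
have : Num.max X (Num.max Y Z) <= y by rewrite -ler_expR -xE.
rewrite !ge_max => /and3P[/HX hX /HY[hY0 hY] /HZ hZ].
rewrite iter_lnSr -/y /= xE; set r := t * iter_ln k y in hX *.
have ry : r <= y by apply: le_trans hY; apply: ler_piMl => //; exact: ltW.
apply: (@le_trans _ _ (y * expR (b * y))).
  by apply: ler_pM; rewrite ?expR_ge0 ?ler_expR // mulr_ge0 // ltW.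
have -> : expR y = expR ((1 - b) * y) * expR (b * y) by rewrite -expRD; congr expR; ring.
by rewrite mulrA ler_wpM2r ?expR_ge0.
Qed.

(** The base case has no room: the constant is t itself, and t < 1 is what the first
    step needs. *)
Lemma exp_val_iter_ln k (t : R) : 0 < t < 1 ->
  exists2 c, c < 1 & exists X, forall x, X <= x ->
    t * iter_ln k x * exp_val k (t * iter_ln k x) <= c * x.
Proof.
move=> t01; elim: k => [|k [b b1 IH]].
  by exists t; [case/andP: t01|exists 0 => x _; rewrite /= mulr1].
exists 2^-1; first by rewrite invf_lt1 // ltr1n.
by apply: exp_val_iter_ln_step IH.
Qed.

Lemma exp_iter_asymptotic k (e : R) : 0 < e ->
  \forall n \near \oo, 0 < iter_ln k.+1 (n%:R : R) /\
    exp_iter R k.+2 n <= ((1 + e) / iter_ln k.+1 (n%:R : R)) ^+ n.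
Proof.
move=> e0; pose c := ln (1 + e) / 2.
have c0 : 0 < c by rewrite divr_gt0 // ln_gt0 // ltrDl.
(* With this choice exp(c) / t = exp(2 c) = 1 + e. *)
pose t := expR (- c).
have t01 : 0 < t < 1 by rewrite expR_gt0 expR_lt1 oppr_lt0.
have [b b1 H] := exp_val_iter_ln k t01.
have [X HX] := exp_val_iter_ln_step t01 b1 c0 H.
have [Y HY] := iter_ln_large k.+1 1.
near=> n.
have /HX hX : X <= n%:R by near: n; exact: nbhs_infty_ger.
have /HY[hY _] : Y <= n%:R by near: n; exact: nbhs_infty_ger.
set L := iter_ln k.+1 (n%:R : R) in hX hY *.
have L0 : 0 < L by apply: lt_le_trans hY.
have tpos : 0 < t by case/andP: t01.
split=> //; apply: (le_trans (exp_iter_le k.+2 n (mulr_gt0 tpos L0))).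
rewrite ler_pdivrMr ?exprn_gt0 ?mulr_gt0 // -exprMn mulrCA mulfVK ?gt_eqF //.
have -> : t * (1 + e) = expR c.
  have -> : 1 + e = expR (c + c) by rewrite -mulr2n -mulr_natr divfK ?lnK // posrE addr_gt0.
  by rewrite -expRD; congr expR; ring.
by rewrite -expRM_natr [exp_val k.+2 _]/= ler_expR.
Unshelve. all: by end_near. Qed.

(** The sequence o is the excess of (u n)^(1/n) L n over 1. *)
Lemma asymptotic_form (u L : nat -> R) : (forall n, 0 <= u n) ->
  (forall e, 0 < e -> \forall n \near \oo, 0 < L n /\ u n <= ((1 + e) / L n) ^+ n) ->
  exists o : nat -> R, o n @[n --> \oo] --> (0 : R) /\
    \forall n \near \oo, u n <= (1 + o n) ^+ n / L n ^+ n.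
Proof.
move=> u0 H; pose root n := u n `^ (n%:R^-1).
have rootX n : (0 < n)%N -> root n ^+ n = u n.
  move=> n0; rewrite -powR_mulrn ?powR_ge0 // -powRrM mulVf ?powRr1 //.
  by rewrite pnatr_eq0 -lt0n.
exists (fun n => Num.max 0 (root n * L n - 1)); split.
  apply/cvgrPdist_le => e e0; near=> n.
  have [Ln un] : 0 < L n /\ u n <= ((1 + e) / L n) ^+ n by near: n; exact: H.
  have n0 : (0 < n)%N by near: n; exact: nbhs_infty_gt.
  rewrite sub0r normrN ger0_norm ?le_max ?lexx // ge_max ltW //=.
  rewrite lerBlDl -ler_pdivlMr //.
  have q0 : 0 <= (1 + e) / L n by apply: ltW; rewrite divr_gt0 ?addr_gt0.
  by rewrite -(@ler_pXn2r _ n) ?nnegrE ?powR_ge0 ?rootX.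
near=> n.
have [Ln _] : 0 < L n /\ u n <= ((1 + 1) / L n) ^+ n by near: n; exact: H.
have n0 : (0 < n)%N by near: n; exact: nbhs_infty_gt.
rewrite ler_pdivlMr ?exprn_gt0 // -rootX // -exprMn.
apply: lerXn2r.
- by rewrite nnegrE mulr_ge0 ?powR_ge0 // ltW.
- by rewrite nnegrE addr_ge0 // le_max lexx.
by rewrite -lerBlDl le_max lexx orbT.
Unshelve. all: by end_near. Qed.

End Asymptotics.

(** * The theorem *)

Theorem theorem2p1 (R : realType) (K : fieldType) (m : nat)
    (W : poissonAlgType K -> Prop) :
  (3 <= m)%N ->
  is_variety W ->
  (exists f : free_lie K,
     [/\ f <> 0, has_lie_degree f m & forall A, W A -> satisfies A (sym_inj f)]) ->
  fps_le (complexity R W) (q_tilde R m) /\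
  exists o : nat -> R,
    o n @[n --> \oo] --> (0 : R) /\
    \forall n \near \oo,
      (codim W n)%:R <=
        n`!%:R / (iter_ln (m - 2) (n%:R : R)) ^+ n * (1 + o n) ^+ n.
Proof.
case: m => [|[|[|k]]] // _ Wvar [f [_ fdeg fW]].
have fact_pos n : 0 < n`!%:R :> R by rewrite ltr0n fact_gt0.
have cod n : complexity R W n <= exp_iter R k.+2 n.
  rewrite /complexity ler_pdivrMr // mulrC.
  have := @size_poisson_gens R K _ (fun i => relfree_pi W (poisson_var K i)) k.+1 (iota 1 n).
  rewrite size_iota; apply: le_trans; rewrite ler_nat.
  exact: codim_le_size_poisson_gens fW.
rewrite /q_tilde (_ : (k.+3 - 2)%N = k.+1) //; split.
  by move=> n; rewrite -exp_iter_tower.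
have [] := @asymptotic_form R (complexity R W) (fun n => iter_ln k.+1 (n%:R : R)).
- by move=> n; rewrite divr_ge0.
- move=> e e0; near=> n; have [L0 Le] : 0 < iter_ln k.+1 (n%:R : R) /\
      exp_iter R k.+2 n <= ((1 + e) / iter_ln k.+1 (n%:R : R)) ^+ n.
    by near: n; exact: exp_iter_asymptotic.
  by split=> //; exact: le_trans (cod n) Le.
move=> w [w0 wP]; exists w; split=> //; apply: filterS wP => n.
rewrite ler_pdivrMr // => /le_trans; apply.
by rewrite mulrC mulrA [X in X <= _]mulrAC.
Unshelve. all: by end_near. Qed.
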